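(* Let $T>0$ and let $\psi$ be any solution of the heat equation $$\psi_t-\psi_{xx}=0,\quad x\in(-1,1),\ t\in(0,T).$$ Then for all $T'\in(0,T)$, $\psi(\cdot,T')\in H(\mathcal{R})$, i.e. $\psi(\cdot,T')$ extends from $(-1,1)$ to a holomorphic function on $\mathcal{R}:=\{z=x+iy\in\mathbb{C};\ |x|+|y|<1\}$.
   Context: $H(\Omega)$ denotes the set of holomorphic functions on the open set $\Omega\subset\mathbb{C}$. No boundary or initial conditions are imposed on $\psi$. A solution may be understood in the sense of distributions on $(-1,1)\times(0,T)$; by hypoellipticity such a solution is a $C^\infty$ function on $(-1,1)\times(0,T)$. *)

(* Defs.v *)
From Stdlib Require Import Reals.
From Coquelicot Require Import Coquelicot.

Open Scope R_scope.

Definition cylinder (T : R) (p : R * R) : Prop :=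
  -1 < fst p < 1 /\ 0 < snd p < T.

(* C_c^oo of the cylinder. Since the cylinder is an open box, having compact
   support in it amounts to vanishing outside some closed sub-box. *)
Definition test_function (T : R) (phi : R -> R -> R) : Prop :=
  (forall (n : nat) (x t : R), ex_diff_n phi n x t) /\
  exists a b c d : R,
    -1 < a /\ b < 1 /\ 0 < c /\ d < T /\
    forall x t : R, ~ (a <= x <= b /\ c <= t <= d) -> phi x t = 0.

(* phi_t + phi_xx, the formal adjoint of the heat operator applied to phi. *)
Definition heat_adjoint (phi : R -> R -> R) (x t : R) : R :=
  Derive (fun s => phi x s) t + Derive_n (fun y => phi y t) 2 x.

(* psi_t - psi_xx = 0 in the sense of distributions. By hypoellipticity such a
   solution is smooth; continuity is what selects that representative, so that
   the values psi x t make sense (a locally integrable psi could be altered on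
   a null set). The values of psi off the cylinder are irrelevant. The
   integrand is continuous, so the integral over the cylinder is an iterated
   Riemann integral; real test functions suffice by linearity. *)
Definition heat_solution (T : R) (psi : R -> R -> C) : Prop :=
  (forall p : R * R, cylinder T p ->
     continuous (U := C_UniformSpace)
       (fun q : R * R => psi (fst q) (snd q)) p) /\
  forall phi : R -> R -> R, test_function T phi ->
    RInt (V := C_R_CompleteNormedModule)
      (fun t => RInt (V := C_R_CompleteNormedModule)
         (fun x => Cmult (RtoC (heat_adjoint phi x t)) (psi x t)) (-1) 1)
      0 T = RtoC 0.

Definition holomorphic_on (Omega : C -> Prop) (f : C -> C) : Prop :=
  forall z : C, Omega z -> ex_derive (K := C_AbsRing) (V := C_NormedModule) f z.

Definition square (z : C) : Prop := Rabs (Re z) + Rabs (Im z) < 1.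

(* Main.v *)
Require Import Defs.
From Stdlib Require Import Reals.
From Coquelicot Require Import Coquelicot.
From Stdlib Require Import Lra Lia FunctionalExtensionality Classical.

(* The heat kernel K(z - y, T' - s) solves the backward heat equation in (y, s) for
   every complex z, and it stays bounded, with all derivatives, as s -> T' wherever
   Re (z - y)^2 > 0. For z in the square |x| + |y| < r this holds for all real y
   with |y| >= r. Testing psi against chi(y) K(z - y, T' - s), with a cutoff chi
   equal to 1 on [-r, r], leaves only commutator terms supported in |y| >= r, so the
   pairing Phi(s; z) has a limit as s -> T', with a remainder estimate in z that is
   uniform in s: the limit is holomorphic. For real z the kernel is an approximate
   identity and the limit is a constant times psi(z, T'). The same off-diagonal
   decay makes the limit independent of chi, which glues the extensions for
   different r without the identity theorem. *)

(** For non-real z the modulus of K(z - y, T' - s) blows up near y = Re z as s -> T', so the pairing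
    cannot be estimated directly at times close to T'. It is estimated at T' / 2, where the width of
    the kernel is fixed, and its variation from there on is carried by the commutator terms, which
    do not see the bad region. The Taylor remainder K(z + h) - K(z) - h K'(z) is again a backward
    solution, of size |h|^2 at T' / 2 and on |y| >= r; the same estimate therefore yields complex
    differentiability of the limit.

    The equation enters through the pairings of psi(., t) with a fixed smooth function of x, for
    which it is an ordinary differential equation in t. All derivatives fall on the cutoff and the
    kernel, and psi is handled as a merely continuous function. Its real and imaginary parts are
    extended separately and recombined linearly. The mass of the kernel is kept as a constant 2 g
    and divided out at the end. *)

(** * Smooth functions of one variable *)

(* Equations whose type is displayed as R only up to unfolding of Coquelicot's structures. *)
Ltac Rring := match goal with |- @eq _ ?x ?y => change (@eq R x y); ring end.

(** The derivative is an existential witness, so that closure under sums, products and composition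
    is an induction on n with no higher Leibniz or chain rule. *)
Fixpoint smooth_n (n : nat) (f : R -> R) : Prop :=
  match n with
  | O => forall x, continuous f x
  | S n => exists g, (forall x, is_derive f x (g x)) /\ smooth_n n g
  end.

Definition smooth (f : R -> R) : Prop := forall n, smooth_n n f.

Lemma is_derive_continuous (f : R -> R) (x l : R) : is_derive f x l -> continuous f x.
Proof. intros H. apply (ex_derive_continuous f). now exists l. Qed.

Lemma smooth_n_S (n : nat) : forall f, smooth_n (S n) f -> smooth_n n f.
Proof.
  induction n as [|n IH]; intros f [g [Hd Hg]].
  - intros x. eapply is_derive_continuous, Hd.
  - exists g. split; auto.
Qed.

Lemma smooth_intro (f g : R -> R) :
  (forall x, is_derive f x (g x)) -> smooth g -> smooth f.
Proof.
  intros Hd Hg [|n].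
  - intros x. eapply is_derive_continuous, Hd.
  - exists g. auto.
Qed.

Lemma smooth_deriv (f g : R -> R) :
  (forall x, is_derive f x (g x)) -> smooth f -> smooth g.
Proof.
  intros Hd Hf n. destruct (Hf (S n)) as [g' [Hd' Hg']].
  replace g with g'; auto. extensionality x.
  rewrite <- (is_derive_unique _ _ _ (Hd x)). symmetry. now apply is_derive_unique.
Qed.

Lemma smooth_continuous (f : R -> R) (x : R) : smooth f -> continuous f x.
Proof. intros H. apply (H O). Qed.

Lemma smooth_ex_derive (f : R -> R) (x : R) : smooth f -> ex_derive f x.
Proof. intros H. destruct (H 1%nat) as [g [Hd _]]. now exists (g x). Qed.

Lemma smooth_is_derive (f : R -> R) (x : R) : smooth f -> is_derive f x (Derive f x).
Proof. intros H. now apply Derive_correct, smooth_ex_derive. Qed.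

Lemma smooth_Derive (f : R -> R) : smooth f -> smooth (Derive f).
Proof. intros H. apply (smooth_deriv f); auto. intros x. now apply smooth_is_derive. Qed.

Lemma smooth_n_const (n : nat) : forall c, smooth_n n (fun _ => c).
Proof.
  induction n as [|n IH]; intros c.
  - intros x. apply continuous_const.
  - exists (fun _ => 0). split; auto. intros x. apply (is_derive_const c x).
Qed.

Lemma smooth_n_plus (n : nat) : forall f g, smooth_n n f -> smooth_n n g ->
  smooth_n n (fun x => f x + g x).
Proof.
  induction n as [|n IH]; intros f g.
  - intros Hf Hg x. apply (continuous_plus f g x); auto.
  - intros [f' [Hf Hf']] [g' [Hg Hg']]. exists (fun x => f' x + g' x).
    split; auto. intros x. apply (is_derive_plus f g); auto.
Qed.

Lemma smooth_n_mult (n : nat) : forall f g, smooth_n n f -> smooth_n n g ->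
  smooth_n n (fun x => f x * g x).
Proof.
  induction n as [|n IH]; intros f g.
  - intros Hf Hg x. apply (continuous_mult f g x); auto.
  - intros Hf0 Hg0. generalize (smooth_n_S _ _ Hf0) (smooth_n_S _ _ Hg0).
    destruct Hf0 as [f' [Hf Hf']]. destruct Hg0 as [g' [Hg Hg']].
    exists (fun x => f' x * g x + f x * g' x).
    split; [|now apply smooth_n_plus; apply IH].
    intros x. apply (is_derive_mult f g); auto. intros; apply Rmult_comm.
Qed.

Lemma smooth_n_comp (n : nat) : forall f g, smooth_n n f -> smooth_n n g ->
  smooth_n n (fun x => f (g x)).
Proof.
  induction n as [|n IH]; intros f g.
  - intros Hf Hg x. apply (continuous_comp g f x); auto.
  - intros Hf0 Hg0. generalize (smooth_n_S _ _ Hf0) (smooth_n_S _ _ Hg0).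
    destruct Hf0 as [f' [Hf Hf']]. destruct Hg0 as [g' [Hg Hg']]. intros _ Hg1.
    exists (fun x => g' x * f' (g x)).
    split; [|apply smooth_n_mult; auto].
    intros x. apply (is_derive_comp f g); auto.
Qed.

Lemma smooth_const (c : R) : smooth (fun _ => c).
Proof. intros n. apply smooth_n_const. Qed.

Lemma smooth_id : smooth (fun x => x).
Proof. apply (smooth_intro _ (fun _ => 1)); [|apply smooth_const]. intros x. apply (is_derive_id x). Qed.

Lemma smooth_plus (f g : R -> R) : smooth f -> smooth g -> smooth (fun x => f x + g x).
Proof. intros Hf Hg n. now apply smooth_n_plus. Qed.

Lemma smooth_mult (f g : R -> R) : smooth f -> smooth g -> smooth (fun x => f x * g x).
Proof. intros Hf Hg n. now apply smooth_n_mult. Qed.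

Lemma smooth_comp (f g : R -> R) : smooth f -> smooth g -> smooth (fun x => f (g x)).
Proof. intros Hf Hg n. now apply smooth_n_comp. Qed.

(** From exp y >= y at y = c x / n, raised to the power n. It serves both the flatness of exp(-1/x)
    at 0 and the decay of the heat kernel away from the diagonal, each time with x the inverse of a
    small quantity. *)
Lemma pow_exp_neg_bound (c : R) (n : nat) : 0 < c ->
  exists C, 0 <= C /\ forall x, 0 <= x -> x ^ n * exp (- (c * x)) <= C.
Proof.
  intros Hc. destruct n as [|n].
  { exists 1. split; [lra|]. intros x Hx. simpl.
    assert (exp (- (c * x)) <= exp 0).
    { destruct (Req_dec (c * x) 0) as [E|E].
      - rewrite E, Ropp_0. lra.
      - left. apply exp_increasing. assert (0 <= c * x) by now apply Rmult_le_pos; lra. lra. }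
    rewrite exp_0 in H. lra. }
  set (N := INR (S n)). assert (HN : 0 < N) by (apply lt_0_INR; lia).
  exists ((N / c) ^ S n). split.
  { apply pow_le. apply Rlt_le, Rdiv_lt_0_compat; auto. }
  intros x Hx.
  assert (H : (c * x / N) ^ S n <= exp (c * x)).
  { replace (exp (c * x)) with (exp (c * x / N) ^ S n).
    - apply pow_incr. split.
      + apply Rmult_le_pos; [apply Rmult_le_pos; lra|]. left. now apply Rinv_0_lt_compat.
      + destruct (Req_dec (c * x / N) 0) as [E|E].
        * rewrite E. left. apply exp_pos.
        * generalize (exp_ineq1 _ E). lra.
    - assert (P : forall m y, exp y ^ m = exp (INR m * y)).
      { intros m y. induction m as [|m IH]; simpl pow.
        - simpl. rewrite Rmult_0_l, exp_0. auto.
        - rewrite IH, <- exp_plus, S_INR. f_equal. ring. }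
      rewrite P. f_equal. unfold N. field. unfold N in HN. lra. }
  rewrite exp_Ropp.
  apply Rmult_le_reg_r with (exp (c * x)); [apply exp_pos|].
  rewrite Rmult_assoc, Rinv_l, Rmult_1_r by (apply Rgt_not_eq, exp_pos).
  replace (x ^ S n) with ((N / c) ^ S n * (c * x / N) ^ S n).
  - apply Rmult_le_compat_l; auto. apply pow_le. left. now apply Rdiv_lt_0_compat.
  - rewrite <- Rpow_mult_distr. f_equal. field. lra.
Qed.

Lemma is_derive_quadratic (f : R -> R) (x l C : R) :
  (forall y, Rabs (y - x) <= 1 -> Rabs (f y - f x - l * (y - x)) <= C * (y - x) ^ 2) ->
  is_derive f x l.
Proof.
  intros H. split; [apply is_linear_scal_l|].
  intros x' Hx'. replace x' with x by (now apply is_filter_lim_locally_unique).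
  intros eps.
  assert (Hd : 0 < Rmin 1 (eps / (Rabs C + 1))).
  { apply Rmin_glb_lt; [lra|]. apply Rdiv_lt_0_compat; [apply cond_pos|]. generalize (Rabs_pos C); lra. }
  exists (mkposreal _ Hd). intros y Hy.
  change (Rabs (y - x) < Rmin 1 (eps / (Rabs C + 1))) in Hy.
  change (Rabs (f y - f x - (y - x) * l) <= eps * Rabs (y - x)).
  assert (H1 := Rmin_l 1 (eps / (Rabs C + 1))).
  assert (H2 := Rmin_r 1 (eps / (Rabs C + 1))).
  replace (f y - f x - (y - x) * l) with (f y - f x - l * (y - x)) by ring.
  eapply Rle_trans; [apply H; lra|].
  assert (P := Rabs_pos C). assert (Q := Rabs_pos (y - x)).
  rewrite <- pow2_abs.
  apply Rle_trans with ((Rabs C + 1) * Rabs (y - x) * Rabs (y - x)).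
  { assert (C <= Rabs C) by apply Rle_abs. nra. }
  apply Rmult_le_compat_r; auto.
  apply Rmult_le_reg_r with (/ (Rabs C + 1)); [apply Rinv_0_lt_compat; lra|].
  apply Rle_trans with (Rabs (y - x)); [right; field; lra|].
  unfold Rdiv in H2. lra.
Qed.

(* e_k(x) = x^(-k) exp(-1/x) for x > 0; this family is stable under derivation:
   e_k' = e_(k+2) - k e_(k+1). *)
Definition flat (k : nat) (x : R) : R :=
  if Rlt_dec 0 x then (/ x) ^ k * exp (- / x) else 0.

Lemma flat_pos (k : nat) (x : R) : 0 < x -> 0 < flat k x.
Proof.
  intros Hx. unfold flat. destruct (Rlt_dec 0 x); [|lra].
  apply Rmult_lt_0_compat; [|apply exp_pos]. apply pow_lt. now apply Rinv_0_lt_compat.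
Qed.

Lemma flat_neg (k : nat) (x : R) : x <= 0 -> flat k x = 0.
Proof. intros Hx. unfold flat. destruct (Rlt_dec 0 x); auto; lra. Qed.

Lemma flat_derive (k : nat) (x : R) :
  is_derive (flat k) x (flat (k + 2) x + - INR k * flat (k + 1) x).
Proof.
  destruct (Rtotal_order x 0) as [Hx|[Hx|Hx]].
  - rewrite !flat_neg by lra. replace (0 + - INR k * 0) with 0 by ring.
    apply is_derive_ext_loc with (fun _ => 0); [|apply (is_derive_const 0 x)].
    assert (H : 0 < - x) by lra. exists (mkposreal _ H). intros y Hy.
    change (Rabs (y - x) < - x) in Hy. apply Rabs_lt_between in Hy.
    symmetry. apply flat_neg. lra.
  - subst x. rewrite !flat_neg by lra. replace (0 + - INR k * 0) with 0 by ring.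
    (* Two powers beyond k: boundedness of y^(-k-2) exp(-1/y) makes [flat k y] at most C y^2, hence
       of derivative 0 at the origin. *)
    destruct (pow_exp_neg_bound 1 (k + 2)) as [C [HC H]]; [lra|].
    apply is_derive_quadratic with C. intros y _.
    rewrite (flat_neg k 0) by lra. rewrite !Rminus_0_r, Rmult_0_l, Rminus_0_r.
    unfold flat. destruct (Rlt_dec 0 y) as [Hy|Hy].
    + assert (P := Rinv_0_lt_compat _ Hy).
      assert (H1 := H (/ y)). rewrite Rmult_1_l in H1.
      rewrite Rabs_pos_eq.
      2:{ apply Rmult_le_pos; [apply pow_le; lra|left; apply exp_pos]. }
      apply Rle_trans with ((/ y) ^ (k + 2) * exp (- / y) * y ^ 2).
      * right. rewrite pow_add. field. lra.
      * apply Rmult_le_compat_r; [apply pow2_ge_0|]. apply H1. lra.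
    + rewrite Rabs_R0. apply Rmult_le_pos; auto. apply pow2_ge_0.
  - apply is_derive_ext_loc with (fun x => (/ x) ^ k * exp (- / x)).
    + exists (mkposreal _ Hx). intros y Hy.
      change (Rabs (y - x) < x) in Hy. apply Rabs_lt_between in Hy.
      unfold flat. destruct (Rlt_dec 0 y); auto; lra.
    + unfold flat. destruct (Rlt_dec 0 x); [|lra].
      auto_derive; [split; auto; lra|].
      rewrite !pow_add. destruct k as [|k]; simpl pred.
      * simpl. field. lra.
      * rewrite <- (tech_pow_Rmult _ k). field. lra.
Qed.

Lemma smooth_flat (k : nat) : smooth (flat k).
Proof.
  intros n. revert k. induction n as [|n IH]; intros k.
  - intros x. eapply is_derive_continuous, flat_derive.
  - exists (fun x => flat (k + 2) x + - INR k * flat (k + 1) x). split.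
    + intros x. apply flat_derive.
    + apply smooth_n_plus; auto. apply smooth_n_mult; auto. apply smooth_n_const.
Qed.

(** * Bumps and plateaus *)

Definition bump (a b x : R) : R := flat 0 (x - a) * flat 0 (b - x).

Lemma smooth_bump (a b : R) : smooth (bump a b).
Proof.
  apply smooth_mult; apply smooth_comp; try apply smooth_flat.
  - apply (smooth_plus (fun x => x) (fun _ => - a)); [apply smooth_id|apply smooth_const].
  - apply (smooth_intro _ (fun _ => -1)); [|apply smooth_const].
    intros x. auto_derive; auto; ring.
Qed.

Lemma bump_pos (a b x : R) : a < x < b -> 0 < bump a b x.
Proof. intros H. apply Rmult_lt_0_compat; apply flat_pos; lra. Qed.

Lemma bump_0 (a b x : R) : ~ a < x < b -> bump a b x = 0.
Proof.
  intros H. unfold bump. destruct (Rlt_dec a x).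
  - rewrite (flat_neg 0 (b - x)) by lra. ring.
  - rewrite (flat_neg 0 (x - a)) by lra. ring.
Qed.

Lemma RInt_primitive_derive (f : R -> R) (a x : R) : (forall x, continuous f x) ->
  is_derive (fun x => RInt f a x) x (f x).
Proof.
  intros Hf. apply (is_derive_RInt f (RInt f a) a x); auto.
  apply filter_forall. intros y. apply (@RInt_correct R_CompleteNormedModule).
  apply (@ex_RInt_continuous R_CompleteNormedModule). auto.
Qed.

Lemma ex_RInt_cont (f : R -> R) (a b : R) : (forall x, continuous f x) -> ex_RInt f a b.
Proof. intros H. apply (@ex_RInt_continuous R_CompleteNormedModule). auto. Qed.

Lemma RInt_0_on (f : R -> R) (a b : R) : a <= b -> (forall x, a < x < b -> f x = 0) -> RInt f a b = 0.
Proof.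
  intros Hab H. rewrite (RInt_ext f (fun _ => 0)).
  - rewrite RInt_const. apply Rmult_0_r.
  - intros x. rewrite Rmin_left, Rmax_right by auto. auto.
Qed.

Lemma RInt_Rplus (f g : R -> R) (a b : R) : ex_RInt f a b -> ex_RInt g a b ->
  RInt (fun x => f x + g x) a b = RInt f a b + RInt g a b.
Proof. apply (@RInt_plus R_CompleteNormedModule). Qed.

Lemma RInt_Rminus (f g : R -> R) (a b : R) : ex_RInt f a b -> ex_RInt g a b ->
  RInt (fun x => f x - g x) a b = RInt f a b - RInt g a b.
Proof. apply (@RInt_minus R_CompleteNormedModule). Qed.

Lemma RInt_Rscal (c : R) (f : R -> R) (a b : R) : ex_RInt f a b ->
  RInt (fun x => c * f x) a b = c * RInt f a b.
Proof. apply (@RInt_scal R_CompleteNormedModule). Qed.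

(** It has two uses: scaled, it is the cutoff in space; as a test function in time, its derivative
    compares the values of a function near two instants at distance h. *)
Definition plateau (p q h : R) : R -> R :=
  fun x => RInt (fun s => bump p q s - bump p q (s - h)) p x.

Lemma bump_diff_smooth (p q h : R) : smooth (fun s => bump p q s - bump p q (s - h)).
Proof.
  apply (smooth_plus (bump p q) (fun s => - bump p q (s - h))); [apply smooth_bump|].
  apply (smooth_intro _ (fun s => -1 * Derive (bump p q) (s + - h))).
  - intros x. evar_last.
    + apply (is_derive_opp (fun s => bump p q (s - h))).
      apply (is_derive_comp (bump p q) (fun s => s - h)).
      * apply smooth_is_derive, smooth_bump.
      * auto_derive; auto.
    + unfold opp, scal; simpl; unfold mult; simpl. unfold Rminus. ring.
  - apply smooth_mult; [apply smooth_const|].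
    apply (smooth_comp (Derive (bump p q)) (fun x => x + - h)).
    + apply smooth_Derive, smooth_bump.
    + apply smooth_plus; [apply smooth_id|apply smooth_const].
Qed.

Lemma plateau_derive (p q h x : R) :
  is_derive (plateau p q h) x (bump p q x - bump p q (x - h)).
Proof.
  apply (RInt_primitive_derive (fun s => bump p q s - bump p q (s - h))).
  intros y. apply (smooth_continuous (fun s => bump p q s - bump p q (s - h))). apply bump_diff_smooth.
Qed.

Lemma smooth_plateau (p q h : R) : smooth (plateau p q h).
Proof. apply (smooth_intro _ _ (plateau_derive p q h)), bump_diff_smooth. Qed.

Lemma RInt_shift (f : R -> R) (a b h : R) : (forall x, continuous f x) ->
  RInt (fun s => f (s - h)) a b = RInt f (a - h) (b - h).
Proof.
  intros Hf. rewrite <- (RInt_comp f (fun s => s - h) (fun _ => 1)); auto.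
  - apply RInt_ext. intros x _. symmetry. apply (@scal_one R_Ring).
  - intros x _. split; [auto_derive; auto|apply continuous_const].
Qed.

Lemma bump_continuous (p q x : R) : continuous (bump p q) x.
Proof. apply smooth_continuous, smooth_bump. Qed.

Lemma bump_mass (p q x y : R) : p < q -> x <= p -> q <= y ->
  RInt (bump p q) x y = RInt (bump p q) p q.
Proof.
  intros Hpq Hx Hy.
  assert (E : forall a b, ex_RInt (bump p q) a b) by (intros; apply ex_RInt_cont, bump_continuous).
  rewrite <- (RInt_Chasles (bump p q) x p y) by auto.
  rewrite <- (RInt_Chasles (bump p q) p q y) by auto.
  rewrite (RInt_0_on _ x p), (RInt_0_on _ q y); auto.
  - unfold plus; simpl. ring.
  - intros z Hz. apply bump_0. lra.
  - intros z Hz. apply bump_0. lra.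
Qed.

(** Two partial masses of the same bump: both vanish up to p, both are complete from q + h on, and
    between q and p + h the first is complete while the second has not begun. *)
Lemma plateau_split (p q h x : R) :
  plateau p q h x = RInt (bump p q) p x - RInt (bump p q) (p - h) (x - h).
Proof.
  unfold plateau. rewrite (RInt_Rminus (bump p q) (fun s => bump p q (s - h))).
  - rewrite (RInt_shift (bump p q)); auto. apply bump_continuous.
  - apply ex_RInt_cont, bump_continuous.
  - apply ex_RInt_cont. intros y.
    apply (continuous_comp (fun s => s - h) (bump p q)); [|apply bump_continuous].
    apply (continuous_minus (fun s => s) (fun _ => h)); [apply continuous_id|apply continuous_const].
Qed.

Lemma plateau_out (p q h x : R) : p < q -> 0 < h -> x <= p \/ q + h <= x -> plateau p q h x = 0.
Proof.
  intros Hpq Hh [Hx|Hx].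
  - unfold plateau. rewrite <- opp_RInt_swap.
    2:{ apply ex_RInt_cont. intros y. apply (smooth_continuous (fun s => bump p q s - bump p q (s - h))), bump_diff_smooth. }
    rewrite RInt_0_on; auto. { apply Ropp_0. }
    intros y Hy. rewrite !bump_0; lra.
  - rewrite plateau_split, (bump_mass p q p x), (bump_mass p q (p - h) (x - h)) by lra. ring.
Qed.

Lemma plateau_in (p q h x : R) : p < q -> 0 < h -> q <= x <= p + h ->
  plateau p q h x = RInt (bump p q) p q.
Proof.
  intros Hpq Hh Hx. rewrite plateau_split, bump_mass by lra.
  rewrite (RInt_0_on _ (p - h) (x - h)); [ring|lra|].
  intros y Hy. apply bump_0. lra.
Qed.

Lemma bump_mass_pos (p q : R) : p < q -> 0 < RInt (bump p q) p q.
Proof.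
  intros H. apply RInt_gt_0; auto.
  - intros x Hx. now apply bump_pos.
  - intros x _. apply bump_continuous.
Qed.

(** Both partial derivatives of a product of this form are again of this form, so the induction
    closes. *)
Lemma ex_diff_n_prod (n : nat) : forall (al be : R -> R) (x t : R), smooth al -> smooth be ->
  ex_diff_n (fun x t => al x * be t) n x t.
Proof.
  assert (C : forall (al be : R -> R) (x t : R), smooth al -> smooth be ->
    continuity_2d_pt (fun x t => al x * be t) x t).
  { intros al be x t Ha Hb. apply continuity_2d_pt_mult.
    - apply (continuity_1d_2d_pt_comp al (fun u _ => u)); [|apply continuity_2d_pt_id1].
      now apply continuity_pt_filterlim, smooth_continuous.
    - apply (continuity_1d_2d_pt_comp be (fun _ v => v)); [|apply continuity_2d_pt_id2].
      now apply continuity_pt_filterlim, smooth_continuous. }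
  induction n as [|n IH]; intros al be x t Ha Hb; split; auto.
  assert (D1 : forall u v, is_derive (fun z => al z * be v) u (Derive al u * be v)).
  { intros u v. evar_last.
    - apply (is_derive_mult al (fun _ => be v)); [now apply smooth_is_derive|apply (is_derive_const (be v) u)|].
      intros; apply Rmult_comm.
    - unfold plus, mult, zero; simpl. ring. }
  assert (D2 : forall u v, is_derive (fun z => al u * be z) v (al u * Derive be v)).
  { intros u v. apply (is_derive_scal be v (al u)). now apply smooth_is_derive. }
  split; [|split; [|split]].
  - eexists; apply D1.
  - eexists; apply D2.
  - replace (fun u v => Derive (fun z => al z * be v) u) with (fun u v => Derive al u * be v).
    + apply IH; auto. now apply smooth_Derive.
    + extensionality u. extensionality v. symmetry. now apply is_derive_unique.
  - replace (fun u v => Derive (fun z => al u * be z) v) with (fun u v => al u * Derive be v).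
    + apply IH; auto. now apply smooth_Derive.
    + extensionality u. extensionality v. symmetry. now apply is_derive_unique.
Qed.

(** * Weak solutions tested on separable functions *)

Definition supported (f : R -> R) (a b : R) : Prop :=
  exists c d, a < c /\ d < b /\ forall x, ~ c <= x <= d -> f x = 0.

Lemma supported_locally (f : R -> R) (a b x : R) : supported f a b -> ~ a < x < b ->
  locally x (fun y => f y = 0).
Proof.
  intros [c [d [Hc [Hd H]]]] Hx. destruct (Rle_dec x a) as [Hxa|Hxa].
  - assert (P : 0 < c - a) by lra. exists (mkposreal _ P). intros y Hy.
    change (Rabs (y - x) < c - a) in Hy. apply Rabs_lt_between in Hy. apply H. lra.
  - assert (P : 0 < b - d) by lra. exists (mkposreal _ P). intros y Hy.
    change (Rabs (y - x) < b - d) in Hy. apply Rabs_lt_between in Hy. apply H. lra.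
Qed.

Lemma is_derive_locally_0 (f : R -> R) (x : R) : locally x (fun y => f y = 0) -> is_derive f x 0.
Proof.
  intros H. apply is_derive_ext_loc with (fun _ => 0); [|apply (is_derive_const 0 x)].
  revert H. apply filter_imp. intros; auto.
Qed.

(** W is arbitrary outside the open interval: f vanishes near each such point. This gives
    integrability up to the boundary of the cylinder, where nothing is known of the solution. *)
Lemma supported_mult_continuous (f W : R -> R) (a b : R) :
  (forall x, continuous f x) -> supported f a b -> (forall x, a < x < b -> continuous W x) ->
  forall x, continuous (fun x => f x * W x) x.
Proof.
  intros Hf Hs HW x.
  assert (D : a < x < b \/ ~ a < x < b) by lra. destruct D as [D|D].
  - apply (continuous_mult f W x); auto.
  - apply (is_derive_continuous _ _ 0), is_derive_locally_0.
    generalize (supported_locally _ _ _ _ Hs D). apply filter_imp. intros y E. rewrite E. ring.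
Qed.

Lemma supported_Derive (f : R -> R) (a b : R) : supported f a b -> supported (Derive f) a b.
Proof.
  intros [c [d [Hc [Hd H]]]]. exists c, d. do 2 (split; auto). intros x Hx.
  apply is_derive_unique, is_derive_locally_0.
  destruct (Rlt_dec x c) as [D|D].
  - assert (P : 0 < c - x) by lra. exists (mkposreal _ P). intros y Hy.
    change (Rabs (y - x) < c - x) in Hy. apply Rabs_lt_between in Hy. apply H. lra.
  - assert (P : 0 < x - d) by lra. exists (mkposreal _ P). intros y Hy.
    change (Rabs (y - x) < x - d) in Hy. apply Rabs_lt_between in Hy. apply H. lra.
Qed.

Lemma supported_mult (f g : R -> R) (a b : R) : supported f a b -> supported (fun x => f x * g x) a b.
Proof.
  intros [c [d [Hc [Hd H]]]]. exists c, d. do 2 (split; auto). intros x Hx. rewrite H; auto. ring.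
Qed.

Lemma supported_mult_continuity_2d (f : R -> R) (u : R -> R -> R) (a b : R) (x t : R) :
  (forall x, continuous f x) -> supported f a b ->
  (forall x, a < x < b -> continuity_2d_pt u x t) ->
  continuity_2d_pt (fun x t => f x * u x t) x t.
Proof.
  intros Hf Hs HW.
  assert (D : a < x < b \/ ~ a < x < b) by lra. destruct D as [D|D].
  - apply continuity_2d_pt_mult; auto.
    apply (continuity_1d_2d_pt_comp f (fun u _ => u)); [|apply continuity_2d_pt_id1].
    apply continuity_pt_filterlim, Hf.
  - apply continuity_2d_pt_ext_loc with (fun _ _ => 0); [|apply continuity_2d_pt_const].
    destruct (supported_locally _ _ _ _ Hs D) as [e He]. exists e. intros y s Hy _.
    rewrite (He y Hy). ring.
Qed.

Lemma continuity_2d_slice1 (g : R -> R -> R) (x t : R) :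
  continuity_2d_pt g x t -> continuous (fun y => g y t) x.
Proof.
  intros H. apply continuity_pt_filterlim, continuity_pt_locally. intros eps. destruct (H eps) as [d Hd]. exists d.
  intros y Hy. apply Hd; auto. rewrite Rminus_diag. rewrite Rabs_R0. apply cond_pos.
Qed.

Lemma continuous_RInt_param (g : R -> R -> R) (a b t : R) : a <= b ->
  locally t (fun t => forall x, a <= x <= b -> continuity_2d_pt g x t) ->
  continuous (fun t => RInt (fun x => g x t) a b) t.
Proof.
  intros Hab Hl. apply continuity_pt_filterlim, continuity_pt_locally. intros eps.
  assert (E : locally t (fun t => ex_RInt (fun x => g x t) a b)).
  { revert Hl. apply filter_imp. intros s Hs. apply (@ex_RInt_continuous R_CompleteNormedModule).
    intros z. rewrite Rmin_left, Rmax_right by auto. intros Hz. now apply continuity_2d_slice1, Hs. }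
  assert (H0 := locally_singleton _ _ Hl).
  (* The added 1 covers a degenerate interval. *)
  assert (He : 0 < eps / (2 * (b - a + 1))).
  { apply Rdiv_lt_0_compat; [apply cond_pos|lra]. }
  destruct (uniform_continuity_2d_1d g a b t H0 (mkposreal _ He)) as [d Hd].
  simpl in Hd.
  assert (L : locally t (fun s => Rabs (s - t) < d)) by (exists d; intros y Hy; apply Hy).
  generalize (filter_and _ _ E L). apply filter_imp. intros s [Es Ls].
  assert (Et := locally_singleton _ _ E). simpl in Et.
  change (Rabs (minus (RInt (fun x => g x s) a b) (RInt (fun x => g x t) a b)) < eps).
  rewrite <- (RInt_minus (V := R_CompleteNormedModule)) by auto.
  eapply Rle_lt_trans.
  - apply (abs_RInt_le_const _ a b (eps / (2 * (b - a + 1)))); auto.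
    + apply (@ex_RInt_minus R_NormedModule); auto.
    + intros x Hx. left. apply Rabs_lt_between in Ls. assert (Q := cond_pos d). apply (Hd x t x s); auto; try lra.
      rewrite Rminus_diag, Rabs_R0. lra.
  - assert (P := cond_pos eps). apply Rmult_lt_reg_r with (2 * (b - a + 1)); [lra|].
    replace ((b - a) * (eps / (2 * (b - a + 1))) * (2 * (b - a + 1))) with ((b - a) * eps) by (field; lra). nra.
Qed.

Lemma locally_interval (a b x : R) : a < x < b -> locally x (fun y => a < y < b).
Proof.
  intros H. assert (P : 0 < Rmin (x - a) (b - x)) by (apply Rmin_glb_lt; lra).
  exists (mkposreal _ P). intros y Hy. change (Rabs (y - x) < Rmin (x - a) (b - x)) in Hy.
  assert (Q := Rmin_l (x - a) (b - x)). assert (Q' := Rmin_r (x - a) (b - x)).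
  apply Rabs_lt_between in Hy. lra.
Qed.

Lemma ex_RInt_in (f : R -> R) (a b c d : R) : a < c < b -> a < d < b ->
  (forall x, a < x < b -> continuous f x) -> ex_RInt f c d.
Proof.
  intros Hc Hd H. apply (@ex_RInt_continuous R_CompleteNormedModule). intros z Hz. apply H.
  destruct (Rle_dec c d).
  - rewrite Rmin_left, Rmax_right in Hz; lra.
  - rewrite Rmin_right, Rmax_left in Hz; lra.
Qed.

Lemma plateau_supported (p q h T : R) : 0 < p < q -> 0 < h -> q + h < T -> supported (plateau p q h) 0 T.
Proof.
  intros Hp Hh Ht. exists p, (q + h). do 2 (split; [lra|]). intros x Hx. apply plateau_out; lra.
Qed.

Lemma plateau_Derive (p q h x : R) : Derive (plateau p q h) x = bump p q x - bump p q (x - h).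
Proof. apply is_derive_unique, plateau_derive. Qed.

(** Otherwise W lies above a level m near t1 and below it near t2. Testing with a bump at t1 minus
    its translate at t2 gives a positive integral of (W - m); subtracting m is free because the test
    function has integral 0. *)
Lemma plateau_orth_monotone (T : R) (W : R -> R) (t1 t2 : R) :
  (forall t, 0 < t < T -> continuous W t) ->
  (forall p q h, 0 < p < q -> 0 < h -> q + h < T ->
    RInt (fun t => Derive (plateau p q h) t * W t) 0 T = 0) ->
  0 < t1 -> t1 < t2 -> t2 < T -> W t1 <= W t2.
Proof.
  intros HW H H1 H12 H2. apply Rnot_lt_le. intros Hlt.
  set (m := (W t1 + W t2) / 2).
  assert (L1 : locally t1 (fun t => m < W t)).
  { refine (HW t1 _ (fun y => m < y) _); [lra|]. apply (open_gt m (W t1)). unfold m; lra. }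
  assert (L2 : locally t2 (fun t => W t < m)).
  { refine (HW t2 _ (fun y => y < m) _); [lra|]. apply (open_lt m (W t2)). unfold m; lra. }
  destruct L1 as [e1 L1]. destruct L2 as [e2 L2].
  (* The radius of the bumps keeps them inside (0, T), disjoint, and within the neighbourhoods where
     W is compared with m. *)
  set (e := Rmin (Rmin e1 e2) (Rmin (Rmin (t1/2) ((T - t2)/2)) ((t2 - t1)/2))).
  assert (He : 0 < e /\ e <= e1 /\ e <= e2 /\ e <= t1/2 /\ e <= (T-t2)/2 /\ e <= (t2 - t1)/2).
  { assert (P1 := cond_pos e1). assert (P2 := cond_pos e2).
    unfold e, Rmin. repeat destruct (Rle_dec _ _); lra. }
  clearbody e. destruct He as [He [He1 [He2 [He3 [He4 He5]]]]].
  set (p := t1 - e). set (q := t1 + e). set (h := t2 - t1).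
  assert (Hp : 0 < p) by (unfold p; lra). assert (Hpq : p < q) by (unfold p, q; lra).
  assert (Hh : 0 < h) by (unfold h; lra). assert (Hq : q + h < T) by (unfold q, h; lra).
  assert (Hqp : q <= p + h) by (unfold q, p, h; lra).
  specialize (H p q h (conj Hp Hpq) Hh Hq).
  set (b := Derive (plateau p q h)) in *.
  assert (Sb : smooth b) by apply smooth_Derive, smooth_plateau.
  assert (Pb : supported b 0 T) by now apply supported_Derive, plateau_supported.
  assert (Cb : forall x, continuous b x) by (intros; now apply smooth_continuous).
  assert (CW := supported_mult_continuous b W 0 T Cb Pb HW).
  assert (I0 : RInt b 0 T = 0).
  { unfold b. rewrite RInt_Derive.
    - rewrite (plateau_out p q h T); [|lra|lra|right; lra]. rewrite (plateau_out p q h 0); [|lra|lra|left; lra]. apply Rminus_diag.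
    - intros. apply smooth_ex_derive, smooth_plateau.
    - intros. apply Cb. }
  set (f := fun t => b t * W t - m * b t).
  assert (Cf : forall x, continuous f x).
  { intros x. apply (continuous_minus (fun t => b t * W t) (fun t => m * b t)); auto.
    apply (continuous_mult (fun _ => m) b); auto. apply continuous_const. }
  assert (If : RInt f 0 T = 0).
  { unfold f. rewrite (RInt_Rminus (fun t => b t * W t) (fun t => m * b t)).
    - rewrite H, RInt_Rscal, I0 by now apply ex_RInt_cont. rewrite Rmult_0_r. apply Rminus_diag.
    - now apply ex_RInt_cont.
    - apply ex_RInt_cont. intros x. apply (continuous_mult (fun _ => m) b); auto. apply continuous_const. }
  assert (Eb : forall t, b t = bump p q t - bump p q (t - h)) by (intros; apply plateau_Derive).
  assert (Pos1 : forall t, p < t < q -> 0 < f t).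
  { intros t Ht. unfold f. rewrite Eb, (bump_0 p q (t - h)) by lra.
    assert (m < W t). { apply L1. change (Rabs (t - t1) < e1). apply Rabs_lt_between. unfold p, q in Ht. lra. }
    assert (B := bump_pos _ _ _ Ht). nra. }
  assert (Pos2 : forall t, 0 <= f t).
  { intros t. assert (D : p < t < q \/ ~ p < t < q) by lra. destruct D as [D|D].
    { left; auto. }
    unfold f. rewrite Eb, (bump_0 p q t) by lra.
    assert (D' : p < t - h < q \/ ~ p < t - h < q) by lra. destruct D' as [D'|D'].
    - assert (W t < m).
      { apply L2. change (Rabs (t - t2) < e2). apply Rabs_lt_between. unfold p, q, h in D'. lra. }
      assert (B := bump_pos _ _ _ D'). nra.
    - rewrite bump_0 by auto. lra. }
  assert (EI : forall c d, ex_RInt f c d) by (intros; now apply ex_RInt_cont).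
  rewrite <- (RInt_Chasles f 0 p T), <- (RInt_Chasles f p q T) in If by auto.
  unfold plus in If; simpl in If.
  assert (0 <= RInt f 0 p) by (apply RInt_ge_0; auto; lra).
  assert (0 < RInt f p q) by (apply RInt_gt_0; auto).
  assert (0 <= RInt f q T) by (apply RInt_ge_0; auto; lra).
  lra.
Qed.

(* Du Bois-Reymond's lemma: subtracting a primitive of G reduces it to W being
   orthogonal to all differences of two translated bumps. *)
Lemma weak_derivative_classical (T : R) (F G : R -> R) :
  (forall t, 0 < t < T -> continuous F t) -> (forall t, 0 < t < T -> continuous G t) ->
  (forall be, smooth be -> supported be 0 T ->
    RInt (fun t => Derive be t * F t + be t * G t) 0 T = 0) ->
  forall t, 0 < t < T -> is_derive F t (G t).
Proof.
  intros HF HG H t Ht.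
  set (P := fun t => RInt G (T / 2) t).
  assert (HP : forall t, 0 < t < T -> is_derive P t (G t)).
  { intros s Hs. apply (is_derive_RInt G P (T / 2) s); auto.
    generalize (locally_interval _ _ _ Hs). apply filter_imp. intros y Hy.
    apply (@RInt_correct R_CompleteNormedModule). apply (ex_RInt_in G 0 T); auto. lra. }
  assert (CP : forall t, 0 < t < T -> continuous P t).
  { intros s Hs. eapply is_derive_continuous, HP, Hs. }
  assert (Q : forall be, smooth be -> supported be 0 T ->
    RInt (fun t => Derive be t * (F t - P t)) 0 T = 0).
  { intros be Sb Pb.
    assert (C1 := supported_mult_continuous (Derive be) F 0 T
      (fun x => smooth_continuous _ x (smooth_Derive _ Sb)) (supported_Derive _ _ _ Pb) HF).
    assert (C2 := supported_mult_continuous (Derive be) P 0 T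
      (fun x => smooth_continuous _ x (smooth_Derive _ Sb)) (supported_Derive _ _ _ Pb) CP).
    assert (C3 := supported_mult_continuous be G 0 T
      (fun x => smooth_continuous _ x Sb) Pb HG).
    assert (I : RInt (fun t => Derive be t * P t + be t * G t) 0 T = 0).
    { apply is_RInt_unique.
      replace 0 with (minus ((fun x => be x * P x) T) ((fun x => be x * P x) 0)) at 2.
      - apply (is_RInt_derive (fun x => be x * P x)).
        + intros x _.
          assert (D : 0 < x < T \/ ~ 0 < x < T) by lra. destruct D as [D|D].
          * apply (is_derive_mult be P); [now apply smooth_is_derive|now apply HP|].
            intros; apply Rmult_comm.
          * assert (E := locally_singleton _ _ (supported_locally _ _ _ _ Pb D)).
            assert (E' := locally_singleton _ _ (supported_locally _ _ _ _ (supported_Derive _ _ _ Pb) D)).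
            simpl in E, E'. rewrite E, E'.
            replace (0 * P x + 0 * G x) with 0 by ring.
            apply is_derive_locally_0.
            generalize (supported_locally _ _ _ _ Pb D). apply filter_imp. intros y Ey. rewrite Ey. ring.
        + intros x _. apply (continuous_plus (fun t => Derive be t * P t) (fun t => be t * G t)); auto.
      - assert (D : ~ 0 < 0 < T) by lra. assert (D' : ~ 0 < T < T) by lra.
        assert (E := locally_singleton _ _ (supported_locally _ _ _ _ Pb D)).
        assert (E' := locally_singleton _ _ (supported_locally _ _ _ _ Pb D')).
        simpl in E, E'. rewrite E, E'. unfold minus, plus, opp; simpl. Rring. }
    assert (I' := H be Sb Pb).
    rewrite (RInt_ext _ (fun t => (Derive be t * F t + be t * G t) - (Derive be t * P t + be t * G t))).
    2:{ intros x _. Rring. }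
    rewrite RInt_Rminus.
    - rewrite I, I'. apply Rminus_diag.
    - apply ex_RInt_cont. intros x. apply (continuous_plus (fun t => Derive be t * F t) (fun t => be t * G t)); auto.
    - apply ex_RInt_cont. intros x. apply (continuous_plus (fun t => Derive be t * P t) (fun t => be t * G t)); auto. }
  assert (M1 : forall t1 t2, 0 < t1 -> t1 < t2 -> t2 < T -> F t1 - P t1 <= F t2 - P t2).
  { intros t1 t2. apply (plateau_orth_monotone T (fun t => F t - P t)).
    - intros s Hs. apply (continuous_minus F P); auto.
    - intros p q h Hp Hh Hq. apply Q; [apply smooth_plateau|now apply plateau_supported]. }
  (* The orthogonality is invariant under a change of sign, so F - P is both nondecreasing and
     nonincreasing, hence constant. *)
  assert (M2 : forall t1 t2, 0 < t1 -> t1 < t2 -> t2 < T -> P t1 - F t1 <= P t2 - F t2).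
  { intros t1 t2. apply (plateau_orth_monotone T (fun t => P t - F t)).
    - intros s Hs. apply (continuous_minus P F); auto.
    - intros p q h Hp Hh Hq.
      assert (E := Q _ (smooth_plateau p q h) (plateau_supported p q h T Hp Hh Hq)).
      rewrite (RInt_ext _ (fun t => -1 * (Derive (plateau p q h) t * (F t - P t)))).
      2:{ intros x _. Rring. }
      rewrite RInt_Rscal.
      + rewrite E. apply Rmult_0_r.
      + apply ex_RInt_cont. apply (supported_mult_continuous _ (fun t => F t - P t) 0 T).
        * intros x. apply smooth_continuous, smooth_Derive, smooth_plateau.
        * now apply supported_Derive, plateau_supported.
        * intros s Hs. apply (continuous_minus F P); auto. }
  apply is_derive_ext_loc with (fun s => P s + (F t - P t)).
  - generalize (locally_interval _ _ _ Ht). apply filter_imp. intros s Hs.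
    destruct (Rtotal_order s t) as [D|[D|D]].
    + assert (A1 := M1 s t). assert (A2 := M2 s t). lra.
    + subst s. Rring.
    + assert (A1 := M1 t s). assert (A2 := M2 t s). lra.
  - evar_last.
    + apply (is_derive_plus P (fun _ => F t - P t)); [now apply HP|apply (is_derive_const (F t - P t) t)].
    + apply Rplus_0_r.
Qed.

(** Testing on products suits the method: for a fixed [al] the identity is the weak form of an
    ordinary differential equation in t. *)
Definition weak_heat (T : R) (u : R -> R -> R) : Prop :=
  (forall x t, -1 < x < 1 -> 0 < t < T -> continuity_2d_pt u x t) /\
  forall al be, smooth al -> supported al (-1) 1 -> smooth be -> supported be 0 T ->
    RInt (fun t => RInt (fun x =>
      (al x * Derive be t + Derive (Derive al) x * be t) * u x t) (-1) 1) 0 T = 0.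

Definition pairing (u : R -> R -> R) (al : R -> R) (t : R) : R :=
  RInt (fun x => al x * u x t) (-1) 1.

Section WeakHeat.

Context (T : R) (u : R -> R -> R) (Hu : weak_heat T u).

Lemma weak_heat_mult_continuity (al : R -> R) (x t : R) :
  (forall x, continuous al x) -> supported al (-1) 1 -> 0 < t < T ->
  continuity_2d_pt (fun x t => al x * u x t) x t.
Proof.
  intros Ca Pa Ht. apply (supported_mult_continuity_2d al u (-1) 1); auto.
  intros y Hy. now apply (proj1 Hu).
Qed.

Lemma ex_RInt_weak_heat (al : R -> R) (t a b : R) :
  (forall x, continuous al x) -> supported al (-1) 1 -> 0 < t < T ->
  ex_RInt (fun x => al x * u x t) a b.
Proof.
  intros Ca Pa Ht. apply ex_RInt_cont. intros x.
  apply (continuity_2d_slice1 (fun x t => al x * u x t)). now apply weak_heat_mult_continuity.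
Qed.

Lemma pairing_continuous (al : R -> R) (t : R) :
  (forall x, continuous al x) -> supported al (-1) 1 -> 0 < t < T ->
  continuous (pairing u al) t.
Proof.
  intros Ca Pa Ht. apply (continuous_RInt_param (fun x t => al x * u x t)); [lra|].
  generalize (locally_interval _ _ _ Ht). apply filter_imp. intros s Hs x _.
  now apply weak_heat_mult_continuity.
Qed.

(** All consequences of the weak equation pass through this lemma. It is du Bois-Reymond's lemma
    applied to two continuous functions of t. *)
Lemma pairing_derive (al : R -> R) (t : R) : smooth al -> supported al (-1) 1 -> 0 < t < T ->
  is_derive (pairing u al) t (pairing u (Derive (Derive al)) t).
Proof.
  intros Sa Pa. revert t.
  assert (Sa2 := smooth_Derive _ (smooth_Derive _ Sa)).
  assert (Pa2 := supported_Derive _ _ _ (supported_Derive _ _ _ Pa)).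
  assert (Ca := fun x => smooth_continuous _ x Sa). assert (Ca2 := fun x => smooth_continuous _ x Sa2).
  apply (weak_derivative_classical T (pairing u al)).
  - intros; now apply pairing_continuous.
  - intros; now apply pairing_continuous.
  - intros be Sb Pb. etransitivity; [|exact (proj2 Hu al be Sa Pa Sb Pb)].
    apply RInt_ext. intros t Ht.
    (* The section does not fix the sign of T; for T < 0 the test function vanishes identically. *)
    destruct (Rle_dec 0 T) as [HT|HT].
    2:{ rewrite Rmin_right, Rmax_left in Ht by lra.
        assert (D : ~ 0 < t < T) by lra.
        assert (E := locally_singleton _ _ (supported_locally _ _ _ _ Pb D)).
        assert (E' := locally_singleton _ _ (supported_locally _ _ _ _ (supported_Derive _ _ _ Pb) D)).
        simpl in E, E'. rewrite E, E'. rewrite RInt_0_on; [Rring|lra|]. intros; Rring. }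
    rewrite Rmin_left, Rmax_right in Ht by auto.
    symmetry. apply is_RInt_unique.
    apply (is_RInt_ext (fun x => plus (scal (Derive be t) (al x * u x t)) (scal (be t) (Derive (Derive al) x * u x t)))).
    { intros x _. unfold plus, scal; simpl; unfold mult; simpl. Rring. }
    apply (@is_RInt_plus R_NormedModule).
    + apply (@is_RInt_scal R_NormedModule), (@RInt_correct R_CompleteNormedModule), ex_RInt_weak_heat; auto.
    + apply (@is_RInt_scal R_NormedModule), (@RInt_correct R_CompleteNormedModule), ex_RInt_weak_heat; auto.
Qed.

End WeakHeat.

(** * Localized pairings with backward heat kernels *)

Lemma is_derive_eps (f : R -> R) (x l : R) :
  (forall eps : posreal, exists d : posreal, forall y, Rabs (y - x) < d ->
     Rabs (f y - f x - (y - x) * l) <= eps * Rabs (y - x)) ->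
  is_derive f x l.
Proof.
  intros H. split; [apply is_linear_scal_l|].
  intros x' Hx'. replace x' with x by (now apply is_filter_lim_locally_unique).
  intros eps. destruct (H eps) as [d Hd]. exists d. intros y Hy. apply (Hd y Hy).
Qed.

Lemma continuity_2d_uniform (g : R -> R -> R) (a b t : R) :
  (forall x, a <= x <= b -> continuity_2d_pt g x t) ->
  forall eps : posreal, exists d : posreal, forall x s, a <= x <= b -> Rabs (s - t) < d ->
    Rabs (g x s - g x t) < eps.
Proof.
  intros H eps. destruct (uniform_continuity_2d_1d g a b t H eps) as [d Hd].
  exists d. intros x s Hx Hs. apply Rabs_lt_between in Hs. assert (P := cond_pos d).
  apply (Hd x t x s); auto; try lra. rewrite Rminus_diag, Rabs_R0. lra.
Qed.

Lemma continuous_Rabs_comp (f : R -> R) (x : R) : continuous f x -> continuous (fun x => Rabs (f x)) x.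
Proof. intros H. apply (continuous_comp f Rabs); [auto|apply continuous_Rabs]. Qed.

Lemma abs_RInt_le_weighted (f w : R -> R) (a b M : R) : a <= b ->
  (forall x, continuous f x) -> (forall x, continuous w x) ->
  (forall x, a < x < b -> Rabs (f x) <= M * Rabs (w x)) ->
  Rabs (RInt f a b) <= M * RInt (fun x => Rabs (w x)) a b.
Proof.
  intros Hab Hf Hw H. eapply Rle_trans; [apply abs_RInt_le; auto; now apply ex_RInt_cont|].
  rewrite <- RInt_Rscal.
  - apply RInt_le; auto.
    + apply ex_RInt_cont. intros; now apply continuous_Rabs_comp.
    + apply ex_RInt_cont. intros x. apply (continuous_mult (fun _ => M) (fun x => Rabs (w x))).
      * apply continuous_const.
      * now apply continuous_Rabs_comp.
  - apply ex_RInt_cont. intros; now apply continuous_Rabs_comp.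
Qed.

Lemma continuity_2d_pt_Rabs (g : R -> R -> R) (x t : R) : continuity_2d_pt g x t ->
  continuity_2d_pt (fun x t => Rabs (g x t)) x t.
Proof.
  intros H. apply (continuity_1d_2d_pt_comp Rabs g); auto.
  apply continuity_pt_filterlim, continuous_Rabs.
Qed.

Lemma continuous_bounded (f : R -> R) (a b : R) : a <= b ->
  (forall x, a <= x <= b -> continuous f x) ->
  exists M, 0 < M /\ forall x, a <= x <= b -> Rabs (f x) <= M.
Proof.
  intros Hab H. destruct (continuity_ab_maj (fun x => Rabs (f x)) a b Hab) as [m [Hm _]].
  - intros c Hc. apply continuity_pt_filterlim.
    apply (continuous_comp f Rabs); [now apply H|apply continuous_Rabs].
  - exists (Rabs (f m) + 1). split; [assert (P := Rabs_pos (f m)); lra|].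
    intros x Hx. specialize (Hm x Hx). lra.
Qed.

(** The equation k_s + k_yy = 0, with the y-derivatives as explicit data so that bounds can be put
    on [k1] directly. Joint continuity serves differentiation under the integral. Nothing is asked
    at s = tau, where the kernel degenerates. *)
Definition backward_heat (tau : R) (k k1 k2 : R -> R -> R) : Prop :=
  forall s, 0 < s < tau -> smooth (fun y => k y s) /\ forall y,
    is_derive (fun y => k y s) y (k1 y s) /\
    is_derive (fun y => k1 y s) y (k2 y s) /\
    is_derive (fun s => k y s) s (- k2 y s) /\
    continuity_2d_pt k y s /\ continuity_2d_pt k1 y s /\ continuity_2d_pt k2 y s.

(** Needed to treat the Taylor remainder of the kernel in z as a backward solution. *)
Lemma backward_heat_lin (tau a b : R) (k k1 k2 l l1 l2 : R -> R -> R) :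
  backward_heat tau k k1 k2 -> backward_heat tau l l1 l2 ->
  backward_heat tau (fun y s => a * k y s + b * l y s)
    (fun y s => a * k1 y s + b * l1 y s) (fun y s => a * k2 y s + b * l2 y s).
Proof.
  intros Hk Hl s Hs. destruct (Hk s Hs) as [Sk Dk]. destruct (Hl s Hs) as [Sl Dl]. split.
  - apply smooth_plus; apply smooth_mult; auto; apply smooth_const.
  - intros y. destruct (Dk y) as (A1 & A2 & A3 & A4 & A5 & A6). destruct (Dl y) as (B1 & B2 & B3 & B4 & B5 & B6).
    assert (D : forall f g x f' g', is_derive f x f' -> is_derive g x g' ->
      is_derive (fun x => a * f x + b * g x) x (a * f' + b * g')).
    { intros f g x f' g' Hf Hg. apply (is_derive_plus (fun x => a * f x) (fun x => b * g x)).
      - now apply (is_derive_scal f).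
      - now apply (is_derive_scal g). }
    assert (C : forall f g y s, continuity_2d_pt f y s -> continuity_2d_pt g y s ->
      continuity_2d_pt (fun y s => a * f y s + b * g y s) y s).
    { intros f g y0 s0 Hf Hg. apply continuity_2d_pt_plus; apply continuity_2d_pt_mult; auto; apply continuity_2d_pt_const. }
    split; [now apply D|]. split; [now apply D|]. split.
    + replace (- (a * k2 y s + b * l2 y s)) with (a * - k2 y s + b * - l2 y s) by ring.
      now apply (D (fun s => k y s) (fun s => l y s)).
    + auto.
Qed.

Section Localized.

Context (T tau : R) (u : R -> R -> R) (Hu : weak_heat T u) (Htau : 0 < tau < T).

Definition localized (chi : R -> R) (k : R -> R -> R) (s : R) : R :=
  pairing u (fun y => chi y * k y s) s.

Context (chi : R -> R) (Schi : smooth chi) (Pchi : supported chi (-1) 1).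

(* The heat equation for u and the backward heat equation for k leave only
   commutator terms, which live where the cutoff is not constant. *)
Lemma localized_derive (k k1 k2 : R -> R -> R) (s : R) : backward_heat tau k k1 k2 -> 0 < s < tau ->
  is_derive (localized chi k) s
    (pairing u (fun y => Derive (Derive chi) y * k y s + 2 * (Derive chi y * k1 y s)) s).
Proof.
  intros Hk Hs. destruct (Hk s Hs) as [Sk Dk].
  set (al := fun y => chi y * k y s).
  assert (Sal : smooth al) by now apply smooth_mult.
  assert (Pal : supported al (-1) 1) by now apply supported_mult.
  assert (HsT : 0 < s < T) by lra.
  assert (DG := pairing_derive T u Hu al s Sal Pal HsT).
  assert (Cchi := fun x => smooth_continuous _ x Schi).
  set (W := fun y s => chi y * u y s).
  assert (CW : forall y t, 0 < t < T -> continuity_2d_pt W y t).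
  { intros y t Ht. apply (weak_heat_mult_continuity T u Hu chi); auto. }
  (* Freezing the kernel at time s leaves a pairing with a fixed function, covered by
     [pairing_derive]; [D] is the error of freezing. The solution is only continuous in t, but in
     [D] it multiplies a difference vanishing at t = s. *)
  set (D := fun t => RInt (fun y => W y t * (k y t - k y s)) (-1) 1).
  set (lD := - RInt (fun y => W y s * k2 y s) (-1) 1).
  assert (CWk : forall t y, 0 < t < tau -> continuous (fun y => W y t * (k y t - k y s)) y).
  { intros t y Ht. apply (continuous_mult (fun y => W y t) (fun y => k y t - k y s)).
    - apply (continuity_2d_slice1 W). apply CW. lra.
    - apply (continuous_minus (fun y => k y t) (fun y => k y s)).
      + apply smooth_continuous, (Hk t Ht).
      + now apply smooth_continuous. }
  assert (CWk2 : forall y, continuous (fun y => W y s * k2 y s) y).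
  { intros y. apply (continuity_2d_slice1 (fun y s => W y s * k2 y s)).
    apply continuity_2d_pt_mult; [now apply CW|]. apply Dk. }
  assert (DD : is_derive D s lD).
  { apply is_derive_eps. intros eps.
    destruct (continuous_bounded (fun y => W y s) (-1) 1) as [Mw [Pw Hw]]; [lra| |].
    { intros y _. apply (continuity_2d_slice1 W). now apply CW. }
    destruct (continuous_bounded (fun y => k2 y s) (-1) 1) as [Mk [Pk HMk]]; [lra| |].
    { intros y _. apply (continuity_2d_slice1 k2). apply Dk. }
    assert (Pe := cond_pos eps).
    (* The error splits into W(t) (k2(xi) - k2(s)) and (W(t) - W(s)) k2(s). Each is at most eps / 4,
       the minimum with 1 giving |W(t)| <= Mw + 1, and integration over length 2 restores eps. *)
    assert (He1 : 0 < Rmin 1 (eps / (4 * Mk))).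
    { apply Rmin_glb_lt; [lra|]. apply Rdiv_lt_0_compat; lra. }
    assert (He2 : 0 < eps / (4 * (Mw + 1))).
    { apply Rdiv_lt_0_compat; lra. }
    destruct (continuity_2d_uniform W (-1) 1 s) with (mkposreal _ He1) as [d1 Hd1].
    { intros; now apply CW. }
    destruct (continuity_2d_uniform k2 (-1) 1 s) with (mkposreal _ He2) as [d2 Hd2].
    { intros; apply Dk. }
    simpl in Hd1, Hd2.
    destruct (locally_interval 0 tau s Hs) as [d3 Hd3].
    assert (Hd : 0 < Rmin d1 (Rmin d2 d3)).
    { repeat apply Rmin_glb_lt; apply cond_pos. }
    exists (mkposreal _ Hd). simpl. intros t Ht.
    assert (T1 : Rabs (t - s) < d1) by (eapply Rlt_le_trans; [exact Ht|apply Rmin_l]).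
    assert (T2 : Rabs (t - s) < d2).
    { eapply Rlt_le_trans; [exact Ht|]. eapply Rle_trans; [apply Rmin_r|apply Rmin_l]. }
    assert (T3 : 0 < t < tau).
    { apply (Hd3 t). change (Rabs (t - s) < d3).
      eapply Rlt_le_trans; [exact Ht|]. eapply Rle_trans; [apply Rmin_r|apply Rmin_r]. }
    assert (E0 : D s = 0).
    { apply RInt_0_on; [lra|]. intros y _. rewrite Rminus_diag. ring. }
    rewrite E0, Rminus_0_r. unfold lD, D.
    replace (RInt (fun y => W y t * (k y t - k y s)) (-1) 1 - (t - s) * - RInt (fun y => W y s * k2 y s) (-1) 1)
      with (RInt (fun y => W y t * (k y t - k y s) + (t - s) * (W y s * k2 y s)) (-1) 1).
    2:{ rewrite RInt_Rplus, RInt_Rscal.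
        - Rring.
        - apply ex_RInt_cont; auto.
        - apply ex_RInt_cont; auto.
        - apply ex_RInt_cont. intros y. apply (continuous_mult (fun _ => t - s) (fun y => W y s * k2 y s)); auto.
          apply continuous_const. }
    replace (eps * Rabs (t - s)) with ((1 - -1) * (eps / 2 * Rabs (t - s))) by field.
    apply abs_RInt_le_const; [lra| |].
    { apply ex_RInt_cont. intros y. apply (continuous_plus (fun y => W y t * (k y t - k y s)) (fun y => (t - s) * (W y s * k2 y s))); auto.
      apply (continuous_mult (fun _ => t - s) (fun y => W y s * k2 y s)); auto.
      apply continuous_const. }
    intros y Hy.
    assert (Hmm : forall x, Rmin s t <= x <= Rmax s t -> 0 < x < tau /\ Rabs (x - s) <= Rabs (t - s)).
    { intros x Hx. destruct (Rle_dec s t).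
      - rewrite Rmin_left, Rmax_right in Hx by lra. split; [lra|]. rewrite !Rabs_pos_eq; lra.
      - rewrite Rmin_right, Rmax_left in Hx by lra. split; [lra|]. rewrite !Rabs_left1; lra. }
    destruct (MVT_gen (fun s => k y s) s t (fun s => - k2 y s)) as [xi [Hxi Exi]].
    { intros x Hx. apply (Hk x). apply Hmm. lra. }
    { intros x Hx. apply continuity_pt_filterlim. eapply is_derive_continuous. apply (Hk x). apply Hmm. lra. }
    rewrite Exi.
    replace (W y t * (- k2 y xi * (t - s)) + (t - s) * (W y s * k2 y s))
      with (- (W y t * (k2 y xi - k2 y s) + (W y t - W y s) * k2 y s) * (t - s)) by ring.
    rewrite Rabs_mult, Rabs_Ropp. apply Rmult_le_compat_r; [apply Rabs_pos|].
    destruct (Hmm xi Hxi) as [_ Hxi'].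
    assert (B1 := Hd1 y t Hy T1). assert (B2 := Hd2 y xi Hy ltac:(lra)).
    assert (B3 := Hw y Hy). assert (B4 := HMk y Hy).
    assert (B1' : Rabs (W y t - W y s) < 1) by (eapply Rlt_le_trans; [exact B1|apply Rmin_l]).
    assert (B1'' : Rabs (W y t - W y s) < eps / (4 * Mk)) by (eapply Rlt_le_trans; [exact B1|apply Rmin_r]).
    assert (B5 : Rabs (W y t) <= Mw + 1).
    { replace (W y t) with (W y s + (W y t - W y s)) by ring. eapply Rle_trans; [apply Rabs_triang|]. lra. }
    eapply Rle_trans; [apply Rabs_triang|]. rewrite !Rabs_mult.
    replace (eps / 2) with ((Mw + 1) * (eps / (4 * (Mw + 1))) + eps / (4 * Mk) * Mk) by (field; lra).
    apply Rplus_le_compat; apply Rmult_le_compat; try apply Rabs_pos; lra. }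
  apply is_derive_ext_loc with (fun t => pairing u al t + D t).
  { generalize (locally_interval 0 tau s Hs). apply filter_imp. intros t Ht.
    unfold pairing, D, localized, pairing. rewrite <- RInt_Rplus.
    - apply RInt_ext. intros y _. unfold al, W. Rring.
    - apply (ex_RInt_weak_heat T u Hu); auto; [|lra]. intros; now apply smooth_continuous.
    - apply ex_RInt_cont. auto. }
  evar_last; [apply (is_derive_plus (pairing u al) D); eassumption|].
  assert (D1 : forall y, is_derive al y (Derive chi y * k y s + chi y * k1 y s)).
  { intros y. apply (is_derive_mult chi (fun y => k y s)).
    - now apply smooth_is_derive.
    - apply Dk.
    - intros; apply Rmult_comm. }
  assert (E1 : Derive al = fun y => Derive chi y * k y s + chi y * k1 y s).
  { extensionality y. apply is_derive_unique, D1. }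
  assert (E2 : Derive (Derive al) = fun y => Derive (Derive chi) y * k y s + 2 * (Derive chi y * k1 y s) + chi y * k2 y s).
  { rewrite E1. extensionality y. apply is_derive_unique. evar_last.
    - apply (is_derive_plus (fun y => Derive chi y * k y s) (fun y => chi y * k1 y s)).
      + apply (is_derive_mult (Derive chi) (fun y => k y s)).
        * apply smooth_is_derive. now apply smooth_Derive.
        * exact (proj1 (Dk y)).
        * intros; apply Rmult_comm.
      + apply (is_derive_mult chi (fun y => k1 y s)).
        * now apply smooth_is_derive.
        * exact (proj1 (proj2 (Dk y))).
        * intros; apply Rmult_comm.
    - unfold plus, mult; simpl. ring. }
  unfold plus; simpl. rewrite E2. unfold pairing, lD.
  (* The product rule contributes chi k2, which cancels against the time derivative of the kernel in
     [lD]; the commutator terms remain. *)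
  apply Rplus_eq_reg_r with (RInt (fun y => W y s * k2 y s) (-1) 1).
  rewrite Rplus_assoc, Rplus_opp_l, Rplus_0_r.
  rewrite <- RInt_Rplus.
  - apply RInt_ext. intros y _. unfold W. Rring.
  - apply (ex_RInt_ext (fun y => (Derive (Derive al) y - chi y * k2 y s) * u y s)).
    { intros y _. rewrite E2. Rring. }
    apply (ex_RInt_ext (fun y => Derive (Derive al) y * u y s - W y s * k2 y s)).
    { intros y _. unfold W. Rring. }
    apply (@ex_RInt_minus R_NormedModule); [|now apply ex_RInt_cont].
    apply (ex_RInt_weak_heat T u Hu); auto.
    + intros. now apply smooth_continuous, smooth_Derive, smooth_Derive.
    + now apply supported_Derive, supported_Derive.
  - now apply ex_RInt_cont.
Qed.

(** The range includes tau, an interior time for the solution, which makes the bounds uniform as s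
    -> tau. *)
Lemma pairing_mass_bounded (f : R -> R) (t1 : R) : (forall x, continuous f x) ->
  supported f (-1) 1 -> 0 < t1 <= tau ->
  exists C, 0 < C /\ forall s, t1 <= s <= tau -> RInt (fun y => Rabs (f y * u y s)) (-1) 1 <= C.
Proof.
  intros Cf Pf Ht1.
  destruct (continuous_bounded (fun s => RInt (fun y => Rabs (f y * u y s)) (-1) 1) t1 tau) as [C [PC HC]]; [lra| |].
  - intros s Hs. apply (continuous_RInt_param (fun y s => Rabs (f y * u y s))); [lra|].
    assert (HsT : 0 < s < T) by lra.
    generalize (locally_interval 0 T s HsT). apply filter_imp. intros s' Hs' y _.
    apply continuity_2d_pt_Rabs. now apply (weak_heat_mult_continuity T u Hu).
  - exists C. split; auto. intros s Hs. eapply Rle_trans; [apply Rle_abs|]. now apply HC.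
Qed.

(** The bound on g is asked only where f is nonzero: with f a derivative of the cutoff, the kernel
    is estimated only far from the diagonal. *)
Lemma pairing_weighted (f g : R -> R) (M s : R) : (forall x, continuous f x) ->
  supported f (-1) 1 -> (forall x, continuous g x) -> 0 < s <= tau ->
  (forall y, -1 < y < 1 -> f y <> 0 -> Rabs (g y) <= M) ->
  Rabs (pairing u (fun y => f y * g y) s) <= M * RInt (fun y => Rabs (f y * u y s)) (-1) 1.
Proof.
  intros Cf Pf Cg Hs H. assert (HsT : 0 < s < T) by lra.
  assert (W : forall f, (forall x, continuous f x) -> supported f (-1) 1 -> forall y, continuous (fun y => f y * u y s) y).
  { intros f0 Cf0 Pf0 y. apply (continuity_2d_slice1 (fun y s => f0 y * u y s)).
    now apply (weak_heat_mult_continuity T u Hu). }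
  apply abs_RInt_le_weighted; [lra| | |].
  - apply W; [|now apply supported_mult]. intros x. now apply (continuous_mult f g).
  - now apply W.
  - intros y Hy. replace (f y * g y * u y s) with (g y * (f y * u y s)) by ring.
    rewrite Rabs_mult. destruct (Req_dec (f y) 0) as [E|E].
    + rewrite E, Rmult_0_l, Rabs_R0, !Rmult_0_r. lra.
    + apply Rmult_le_compat_r; [apply Rabs_pos|auto].
Qed.

Context (r : R) (Hchi : forall y, Rabs y <= r -> chi y = 1).

Lemma cutoff_Derive_0 (y : R) : Rabs y < r -> locally y (fun y => Derive chi y = 0).
Proof.
  intros Hy. assert (H : - r < y < r) by now apply Rabs_lt_between.
  generalize (locally_interval _ _ _ H). apply filter_imp. intros x Hx.
  apply is_derive_unique. apply is_derive_ext_loc with (fun _ => 1); [|apply (is_derive_const 1 x)].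
  generalize (locally_interval _ _ _ Hx). apply filter_imp. intros x' Hx'.
  symmetry. apply Hchi. apply Rabs_le_between. lra.
Qed.

Lemma cutoff_Derive_support (y : R) : Derive chi y <> 0 -> r <= Rabs y.
Proof.
  intros H. apply Rnot_lt_le. intros Hy. apply H.
  exact (locally_singleton _ _ (cutoff_Derive_0 y Hy)).
Qed.

Lemma cutoff_Derive2_support (y : R) : Derive (Derive chi) y <> 0 -> r <= Rabs y.
Proof.
  intros H. apply Rnot_lt_le. intros Hy. apply H.
  apply is_derive_unique, is_derive_locally_0, (cutoff_Derive_0 y Hy).
Qed.

(** By the mean value theorem, since the derivative consists of commutator terms. C depends on the
    solution and the cutoff but not on k: the estimate will be applied to remainders that depend on
    z and h. *)
Lemma localized_lipschitz (t1 : R) : 0 < t1 < tau ->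
  exists C, 0 < C /\ forall k k1 k2 M, 0 <= M -> backward_heat tau k k1 k2 ->
    (forall y s, r <= Rabs y < 1 -> t1 <= s < tau -> Rabs (k y s) <= M /\ Rabs (k1 y s) <= M) ->
    forall s s', t1 <= s < tau -> t1 <= s' < tau ->
      Rabs (localized chi k s' - localized chi k s) <= C * M * Rabs (s' - s).
Proof.
  intros Ht1.
  assert (S1 := smooth_Derive _ Schi). assert (S2 := smooth_Derive _ S1).
  assert (P1 := supported_Derive _ _ _ Pchi). assert (P2 := supported_Derive _ _ _ P1).
  assert (C1 := fun x => smooth_continuous _ x S1). assert (C2 := fun x => smooth_continuous _ x S2).
  destruct (pairing_mass_bounded (Derive chi) t1) as [M1 [PM1 HM1]]; auto; [lra|].
  destruct (pairing_mass_bounded (Derive (Derive chi)) t1) as [M2 [PM2 HM2]]; auto; [lra|].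
  exists (M2 + 2 * M1). split; [lra|].
  intros k k1 k2 M HM0 Hk HM s s' Hs Hs'.
  assert (Hss : forall x, Rmin s s' <= x <= Rmax s s' -> t1 <= x < tau).
  { intros x Hx. unfold Rmin, Rmax in Hx. destruct (Rle_dec s s'); lra. }
  destruct (MVT_gen (localized chi k) s s'
    (fun s => pairing u (fun y => Derive (Derive chi) y * k y s + 2 * (Derive chi y * k1 y s)) s)) as [x [Hx Ex]].
  { intros x Hx. apply (localized_derive k k1 k2); auto. assert (D := Hss x). lra. }
  { intros x Hx. apply continuity_pt_filterlim. eapply is_derive_continuous.
    apply (localized_derive k k1 k2); auto. assert (D := Hss x). lra. }
  rewrite Ex, Rabs_mult. apply Rmult_le_compat_r; [apply Rabs_pos|].
  apply Hss in Hx. assert (Hx0 : 0 < x < tau) by lra. assert (HxT : 0 < x < T) by lra.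
  destruct (Hk x Hx0) as [Sk Dk].
  assert (Ck : forall y, continuous (fun y => k y x) y) by (intros; now apply smooth_continuous).
  assert (Ck1 : forall y, continuous (fun y => k1 y x) y).
  { intros y. eapply is_derive_continuous, Dk. }
  assert (E : pairing u (fun y => Derive (Derive chi) y * k y x + 2 * (Derive chi y * k1 y x)) x =
    pairing u (fun y => Derive (Derive chi) y * k y x) x + 2 * pairing u (fun y => Derive chi y * k1 y x) x).
  { assert (I1 : ex_RInt (fun y => Derive (Derive chi) y * k y x * u y x) (-1) 1).
    { apply (ex_RInt_weak_heat T u Hu (fun y => Derive (Derive chi) y * k y x)); auto.
      - intros y. apply (continuous_mult (Derive (Derive chi)) (fun y => k y x)); auto.
      - now apply supported_mult. }
    assert (I2 : ex_RInt (fun y => Derive chi y * k1 y x * u y x) (-1) 1).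
    { apply (ex_RInt_weak_heat T u Hu (fun y => Derive chi y * k1 y x)); auto.
      - intros y. apply (continuous_mult (Derive chi) (fun y => k1 y x)); auto.
      - now apply supported_mult. }
    unfold pairing. rewrite <- RInt_Rscal by auto. rewrite <- RInt_Rplus; auto.
    - apply RInt_ext. intros y _. Rring.
    - now apply (@ex_RInt_scal R_NormedModule). }
  rewrite E. eapply Rle_trans; [apply Rabs_triang|]. rewrite Rabs_mult, (Rabs_pos_eq 2) by lra.
  assert (B1 : Rabs (pairing u (fun y => Derive (Derive chi) y * k y x) x) <= M * M2).
  { eapply Rle_trans; [apply (pairing_weighted (Derive (Derive chi)) (fun y => k y x) M); auto; try lra|].
    - intros y Hy Dy. apply (HM y x); [|lra]. split; [now apply cutoff_Derive2_support|].
      apply Rabs_lt_between; lra.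
    - apply Rmult_le_compat_l; auto. apply HM2. lra. }
  assert (B2 : Rabs (pairing u (fun y => Derive chi y * k1 y x) x) <= M * M1).
  { eapply Rle_trans; [apply (pairing_weighted (Derive chi) (fun y => k1 y x) M); auto; try lra|].
    - intros y Hy Dy. apply (HM y x); [|lra]. split; [now apply cutoff_Derive_support|].
      apply Rabs_lt_between; lra.
    - apply Rmult_le_compat_l; auto. apply HM1. lra. }
  lra.
Qed.

(** A sequence lets [Lim_seq] define the limit; the shift by 2 makes it start at tau / 2. *)
Definition approach (n : nat) : R := tau * (1 - / (INR n + 2)).

Lemma approach_bounds (n : nat) : tau / 2 <= approach n < tau.
Proof.
  unfold approach. assert (P := pos_INR n).
  assert (I1 : 0 < / (INR n + 2)) by (apply Rinv_0_lt_compat; lra).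
  assert (I2 : / (INR n + 2) <= / 2) by (apply Rinv_le_contravar; lra).
  split; nra.
Qed.

Lemma approach_lim : is_lim_seq approach tau.
Proof.
  unfold approach. apply (is_lim_seq_ext (fun n => tau - tau * / (INR n + 2))).
  { intros n. ring. }
  evar_last.
  - apply is_lim_seq_minus'; [apply is_lim_seq_const|].
    apply (is_lim_seq_scal_l (fun n => / (INR n + 2)) tau 0).
    apply (is_lim_seq_inv _ p_infty); [|discriminate].
    apply (is_lim_seq_plus INR (fun _ => 2) p_infty 2 p_infty).
    + apply is_lim_seq_INR.
    + apply is_lim_seq_const.
    + reflexivity.
  - simpl. f_equal. ring.
Qed.

Lemma localized_cvg (k k1 k2 : R -> R -> R) (M : R) : 0 <= M -> backward_heat tau k k1 k2 ->
  (forall y s, r <= Rabs y < 1 -> tau / 2 <= s < tau -> Rabs (k y s) <= M /\ Rabs (k1 y s) <= M) ->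
  ex_finite_lim_seq (fun n => localized chi k (approach n)).
Proof.
  intros HM Hk HB. destruct (localized_lipschitz (tau / 2)) as [C [PC HC]]; [lra|].
  specialize (HC k k1 k2 M HM Hk HB).
  apply ex_lim_seq_cauchy_corr. intros eps.
  assert (Cau : ex_lim_seq_cauchy approach).
  { apply ex_lim_seq_cauchy_corr. exists tau. apply approach_lim. }
  assert (HCM : 0 <= C * M) by (apply Rmult_le_pos; lra).
  (* M may be 0, hence the added 1. *)
  assert (He : 0 < eps / (C * M + 1)) by (apply Rdiv_lt_0_compat; [apply cond_pos|lra]).
  destruct (Cau (mkposreal _ He)) as [N HN]. exists N. intros n m Hn Hm.
  eapply Rle_lt_trans; [apply HC; apply approach_bounds|].
  specialize (HN n m Hn Hm). simpl in HN.
  replace (pos eps) with ((C * M + 1) * (eps / (C * M + 1))) by (field; lra).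
  assert (P := Rabs_pos (approach n - approach m)). nra.
Qed.

(** The value at tau / 2 plus a Lipschitz variation over a distance at most tau. A bound on the
    kernel for all y is thus required at the single time tau / 2. Linearity in M carries a remainder
    of order |h|^2 through the limit. *)
Lemma localized_bounded : exists C, 0 < C /\ forall k k1 k2 M, 0 <= M -> backward_heat tau k k1 k2 ->
  (forall y s, r <= Rabs y < 1 -> tau / 2 <= s < tau -> Rabs (k y s) <= M /\ Rabs (k1 y s) <= M) ->
  (forall y, Rabs y < 1 -> Rabs (k y (tau / 2)) <= M) ->
  forall n, Rabs (localized chi k (approach n)) <= C * M.
Proof.
  destruct (localized_lipschitz (tau / 2)) as [C [PC HC]]; [lra|].
  assert (Cchi := fun x => smooth_continuous _ x Schi).
  destruct (pairing_mass_bounded chi (tau / 2)) as [C0 [PC0 HC0]]; auto; [lra|].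
  exists (C0 + C * tau). split; [nra|].
  intros k k1 k2 M HM Hk HB HB0 n.
  assert (An := approach_bounds n).
  assert (L := HC k k1 k2 M HM Hk HB (tau / 2) (approach n) ltac:(lra) An).
  assert (B : Rabs (localized chi k (tau / 2)) <= M * C0).
  { eapply Rle_trans; [apply (pairing_weighted chi (fun y => k y (tau / 2)) M); auto; try lra|].
    - intros y. apply smooth_continuous, (Hk (tau / 2)). lra.
    - intros y Hy _. apply HB0. apply Rabs_lt_between; lra.
    - apply Rmult_le_compat_l; auto. apply HC0. lra. }
  replace (localized chi k (approach n)) with
    ((localized chi k (approach n) - localized chi k (tau / 2)) + localized chi k (tau / 2)) by ring.
  eapply Rle_trans; [apply Rabs_triang|].
  rewrite (Rabs_pos_eq (approach n - tau / 2)) in L by lra.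
  assert (C * M * (approach n - tau / 2) <= C * M * tau).
  { apply Rmult_le_compat_l; [apply Rmult_le_pos|]; lra. }
  lra.
Qed.

End Localized.

(** * The complex heat kernel *)

Definition is_Cderive (g : R -> C) (t : R) (l : C) : Prop :=
  is_derive (fun t => Re (g t)) t (Re l) /\ is_derive (fun t => Im (g t)) t (Im l).

Lemma is_Cderive_const (c : C) (t : R) : is_Cderive (fun _ => c) t (RtoC 0).
Proof. split; [apply (is_derive_const (Re c) t)|apply (is_derive_const (Im c) t)]. Qed.

Lemma is_Cderive_plus (f g : R -> C) (t : R) (l m : C) :
  is_Cderive f t l -> is_Cderive g t m -> is_Cderive (fun t => f t + g t)%C t (l + m)%C.
Proof.
  intros [F1 F2] [G1 G2]. split.
  - now apply (is_derive_plus (fun t => Re (f t)) (fun t => Re (g t))).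
  - now apply (is_derive_plus (fun t => Im (f t)) (fun t => Im (g t))).
Qed.

Lemma is_Cderive_mult (f g : R -> C) (t : R) (l m : C) :
  is_Cderive f t l -> is_Cderive g t m ->
  is_Cderive (fun t => f t * g t)%C t (l * g t + f t * m)%C.
Proof.
  intros [F1 F2] [G1 G2].
  assert (M : forall (f g : R -> R) t l m, is_derive f t l -> is_derive g t m ->
    is_derive (fun t => f t * g t) t (l * g t + f t * m)).
  { intros f0 g0 t0 l0 m0 H1 H2. apply (is_derive_mult f0 g0); auto. intros; apply Rmult_comm. }
  split.
  - evar_last.
    + apply (is_derive_minus (fun t => Re (f t) * Re (g t)) (fun t => Im (f t) * Im (g t))); apply M; eauto.
    + unfold minus, plus, opp, Re, Im; simpl. unfold Re, Im. ring.
  - evar_last.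
    + apply (is_derive_plus (fun t => Re (f t) * Im (g t)) (fun t => Im (f t) * Re (g t))); apply M; eauto.
    + unfold plus, Re, Im; simpl. unfold Re, Im. ring.
Qed.

Lemma is_Cderive_scal (c : C) (f : R -> C) (t : R) (l : C) :
  is_Cderive f t l -> is_Cderive (fun t => c * f t)%C t (c * l)%C.
Proof.
  intros H. replace (c * l)%C with (RtoC 0 * f t + c * l)%C by ring.
  apply (is_Cderive_mult (fun _ => c) f); auto. apply is_Cderive_const.
Qed.

Lemma is_Cderive_real (f : R -> R) (t l : R) : is_derive f t l -> is_Cderive (fun t => RtoC (f t)) t (RtoC l).
Proof. intros H. split; [exact H|apply (is_derive_const 0 t)]. Qed.

(* Complex differentiability, phrased along all real lines to reduce it to
   one-variable real calculus. *)
Definition line_derive (f f' : C -> C) : Prop :=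
  forall (w d : C) (t : R), is_Cderive (fun t => f (w + RtoC t * d)%C) t (f' (w + RtoC t * d) * d)%C.

Lemma line_derive_ext (f f' g' : C -> C) : line_derive f f' -> (forall w, f' w = g' w) -> line_derive f g'.
Proof. intros H E w d t. rewrite <- E. apply H. Qed.

Lemma line_derive_plus (f f' g g' : C -> C) : line_derive f f' -> line_derive g g' ->
  line_derive (fun w => f w + g w)%C (fun w => f' w + g' w)%C.
Proof.
  intros Hf Hg w d t. rewrite Cmult_plus_distr_r.
  apply (is_Cderive_plus (fun t => f (w + RtoC t * d)%C) (fun t => g (w + RtoC t * d)%C)); auto.
Qed.

Lemma line_derive_mult (f f' g g' : C -> C) : line_derive f f' -> line_derive g g' ->
  line_derive (fun w => f w * g w)%C (fun w => f' w * g w + f w * g' w)%C.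
Proof.
  intros Hf Hg w d t.
  assert (H := is_Cderive_mult (fun t => f (w + RtoC t * d)%C) (fun t => g (w + RtoC t * d)%C) t _ _ (Hf w d t) (Hg w d t)).
  cbv beta in H.
  match type of H with is_Cderive _ _ ?x => replace (_ * d)%C with x by ring end. exact H.
Qed.

Lemma line_derive_const (c : C) : line_derive (fun _ => c) (fun _ => RtoC 0).
Proof. intros w d t. replace (RtoC 0 * d)%C with (RtoC 0) by ring. apply is_Cderive_const. Qed.

Lemma line_derive_scal (c : C) (f f' : C -> C) : line_derive f f' ->
  line_derive (fun w => c * f w)%C (fun w => c * f' w)%C.
Proof.
  intros H. apply line_derive_ext with (fun w => RtoC 0 * f w + c * f' w)%C.
  - apply (line_derive_mult (fun _ => c) _ f); auto. apply line_derive_const.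
  - intros w. ring.
Qed.

Lemma line_derive_id : line_derive (fun w => w) (fun _ => RtoC 1).
Proof.
  intros w d t. split; simpl; unfold Re, Im; simpl; auto_derive; auto; ring.
Qed.

Lemma line_derive_pow (n : nat) :
  line_derive (fun w => Cpow w n) (fun w => RtoC (INR n) * Cpow w (pred n))%C.
Proof.
  induction n as [|n IH].
  - apply line_derive_ext with (fun _ => RtoC 0); [exact (line_derive_const (RtoC 1))|].
    intros w. simpl. ring.
  - apply line_derive_ext with (fun w => RtoC 1 * Cpow w n + w * (RtoC (INR n) * Cpow w (pred n)))%C.
    + apply (line_derive_mult (fun w => w) (fun _ => RtoC 1) (fun w => Cpow w n)); auto. apply line_derive_id.
    + intros w. rewrite S_INR, RtoC_plus. destruct n as [|n]; simpl; ring.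
Qed.

(** The entire function exp(-w^2 / (4 sg)) in components, from Re w^2 = p^2 - v^2 and Im w^2 = 2 p v
    for w = p + i v. *)
Definition gauss (sg : R) (w : C) : C :=
  (exp (- (Re w ^ 2 - Im w ^ 2) / (4 * sg)) * cos (Re w * Im w / (2 * sg)),
   - (exp (- (Re w ^ 2 - Im w ^ 2) / (4 * sg)) * sin (Re w * Im w / (2 * sg)))).

Lemma gauss_line_derive (sg : R) : 0 < sg ->
  line_derive (gauss sg) (fun w => RtoC (- / (2 * sg)) * w * gauss sg w)%C.
Proof.
  intros Hs [p v] [d e] t. unfold gauss, is_Cderive, Re, Im. simpl.
  split; auto_derive; repeat split; try lra; unfold Rminus, Rdiv;
    match goal with |- context [exp ?x] => generalize (exp x); intros X end;
    match goal with |- context [cos ?x] => generalize (sin x) (cos x); intros Y Z end; field; lra.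
Qed.

Lemma gauss_Cderive_time (w : C) (sg : R) : 0 < sg ->
  is_Cderive (fun s => gauss s w) sg (RtoC (/ (4 * sg ^ 2)) * (w * w) * gauss sg w)%C.
Proof.
  intros Hs. destruct w as [p v]. unfold gauss, is_Cderive, Re, Im. simpl.
  split; auto_derive; repeat split; try lra; unfold Rminus, Rdiv;
    match goal with |- context [exp ?x] => generalize (exp x); intros X end;
    match goal with |- context [cos ?x] => generalize (sin x) (cos x); intros Y Z end; field; lra.
Qed.

Lemma Cmod_gauss (sg : R) (w : C) : Cmod (gauss sg w) = exp (- (Re w ^ 2 - Im w ^ 2) / (4 * sg)).
Proof.
  unfold gauss, Cmod. set (x := exp _). set (y := _ / (2 * sg)). simpl.
  replace (_ + _) with (x ^ 2 * ((sin y)² + (cos y)²)) by (unfold Rsqr; ring).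
  rewrite sin2_cos2, Rmult_1_r. apply sqrt_pow2. left. apply exp_pos.
Qed.

(* w^a sg^(-b/2) exp(-w^2/(4 sg)): these span the derivatives of the heat kernel,
   which up to a constant is [gker 0 1]. *)
Definition gker (a b : nat) (sg : R) (w : C) : C :=
  (RtoC ((/ sqrt sg) ^ b) * (Cpow w a * gauss sg w))%C.

Lemma inv_sqrt_sq (sg : R) : 0 < sg -> (/ sqrt sg) ^ 2 = / sg.
Proof.
  intros H. rewrite pow_inv. f_equal. rewrite <- (sqrt_sqrt sg) at 2 by lra. ring.
Qed.

Lemma gker_line_derive (a b : nat) (sg : R) : 0 < sg ->
  line_derive (gker a b sg) (fun w => RtoC (INR a) * gker (pred a) b sg w + RtoC (- / 2) * gker (S a) (b + 2) sg w)%C.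
Proof.
  intros Hs. unfold gker.
  eapply line_derive_ext.
  - apply (line_derive_scal (RtoC ((/ sqrt sg) ^ b)) (fun w => Cpow w a * gauss sg w)%C).
    refine (line_derive_mult (fun w => Cpow w a) _ (gauss sg) _ _ _).
    + apply line_derive_pow.
    + now apply gauss_line_derive.
  - intros w. cbv beta. rewrite pow_add, inv_sqrt_sq by auto.
    replace (- / (2 * sg)) with (- / 2 * / sg) by (field; lra).
    rewrite !RtoC_mult. simpl Cpow. ring.
Qed.

Lemma inv_sqrt_pow_derive (b : nat) (sg : R) : 0 < sg ->
  is_derive (fun s => (/ sqrt s) ^ b) sg (- (INR b / 2) * (/ sqrt sg) ^ (b + 2)).
Proof.
  intros Hs. assert (P := sqrt_lt_R0 _ Hs).
  evar_last.
  - apply (is_derive_pow (fun s => / sqrt s) b sg (- / 2 * (/ sqrt sg) ^ 3)).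
    auto_derive; [repeat split; lra|].
    assert (E : sqrt sg * sqrt sg = sg) by (apply sqrt_sqrt; lra). field. lra.
  - destruct b as [|b]; simpl pred.
    + match goal with |- @eq _ ?x ?y => change (@eq R x y) end. simpl. field. lra.
    + rewrite !pow_add. match goal with |- @eq _ ?x ?y => change (@eq R x y) end. simpl (_ ^ _). field. lra.
Qed.

Lemma gker_Cderive_time (a b : nat) (w : C) (sg : R) : 0 < sg ->
  is_Cderive (fun s => gker a b s w) sg
    (RtoC (- (INR b / 2)) * gker a (b + 2) sg w + RtoC (/ 4) * gker (a + 2) (b + 4) sg w)%C.
Proof.
  intros Hs. unfold gker.
  assert (H := is_Cderive_mult (fun s => RtoC ((/ sqrt s) ^ b)) (fun s => Cpow w a * gauss s w)%C sg _ _
    (is_Cderive_real _ _ _ (inv_sqrt_pow_derive b sg Hs))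
    (is_Cderive_scal (Cpow w a) (fun s => gauss s w) sg _ (gauss_Cderive_time w sg Hs))).
  cbv beta in H.
  match type of H with is_Cderive _ _ ?x => match goal with |- is_Cderive _ _ ?y => replace y with x; [exact H|] end end.
  replace ((/ sqrt sg) ^ (b + 4)) with ((/ sqrt sg) ^ b * (/ sg * / sg)).
  2:{ replace (b + 4)%nat with (b + 2 + 2)%nat by lia. rewrite !pow_add, inv_sqrt_sq by auto. ring. }
  replace (/ (4 * sg ^ 2)) with (/ 4 * (/ sg * / sg)) by (field; lra).
  rewrite !pow_add, inv_sqrt_sq by auto. rewrite !RtoC_mult.
  rewrite Cpow_add_r. simpl (Cpow w 2). ring.
Qed.

Definition continuity_2d_C (f : R -> R -> C) (x t : R) : Prop :=
  continuity_2d_pt (fun x t => Re (f x t)) x t /\ continuity_2d_pt (fun x t => Im (f x t)) x t.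

Lemma continuity_2d_C_const (c : C) (x t : R) : continuity_2d_C (fun _ _ => c) x t.
Proof. split; apply continuity_2d_pt_const. Qed.

Lemma continuity_2d_C_plus (f g : R -> R -> C) (x t : R) :
  continuity_2d_C f x t -> continuity_2d_C g x t -> continuity_2d_C (fun x t => f x t + g x t)%C x t.
Proof.
  intros [F1 F2] [G1 G2]. split.
  - now apply (continuity_2d_pt_plus (fun x t => Re (f x t)) (fun x t => Re (g x t))).
  - now apply (continuity_2d_pt_plus (fun x t => Im (f x t)) (fun x t => Im (g x t))).
Qed.

Lemma continuity_2d_C_mult (f g : R -> R -> C) (x t : R) :
  continuity_2d_C f x t -> continuity_2d_C g x t -> continuity_2d_C (fun x t => f x t * g x t)%C x t.
Proof.
  intros [F1 F2] [G1 G2]. split.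
  - apply (continuity_2d_pt_minus (fun x t => Re (f x t) * Re (g x t)) (fun x t => Im (f x t) * Im (g x t)));
      now apply continuity_2d_pt_mult.
  - apply (continuity_2d_pt_plus (fun x t => Re (f x t) * Im (g x t)) (fun x t => Im (f x t) * Re (g x t)));
      now apply continuity_2d_pt_mult.
Qed.

Lemma continuity_2d_C_pow (f : R -> R -> C) (n : nat) (x t : R) :
  continuity_2d_C f x t -> continuity_2d_C (fun x t => Cpow (f x t) n) x t.
Proof.
  intros H. induction n as [|n IH]; simpl.
  - apply continuity_2d_C_const.
  - now apply (continuity_2d_C_mult f).
Qed.

Lemma continuity_2d_pt_comp1 (f : R -> R) (g : R -> R -> R) (x t : R) :
  continuity_2d_pt g x t -> continuous f (g x t) -> continuity_2d_pt (fun x t => f (g x t)) x t.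
Proof. intros Hg Hf. apply continuity_1d_2d_pt_comp; auto. apply continuity_pt_filterlim, Hf. Qed.

Lemma gauss_continuity_2d (f : R -> R -> R) (g : R -> R -> C) (x t : R) : 0 < f x t ->
  continuity_2d_pt f x t -> continuity_2d_C g x t -> continuity_2d_C (fun x t => gauss (f x t) (g x t)) x t.
Proof.
  intros Hf Cf [G1 G2].
  assert (E : continuity_2d_pt (fun x t => exp (- (Re (g x t) ^ 2 - Im (g x t) ^ 2) / (4 * f x t))) x t).
  { apply (continuity_2d_pt_comp1 exp (fun x t => - (Re (g x t) ^ 2 - Im (g x t) ^ 2) / (4 * f x t))); [|apply continuous_exp].
    apply continuity_2d_pt_mult.
    - apply continuity_2d_pt_opp, continuity_2d_pt_minus; simpl; repeat apply continuity_2d_pt_mult; auto; apply continuity_2d_pt_const.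
    - apply continuity_2d_pt_inv; [|lra]. apply continuity_2d_pt_mult; auto; apply continuity_2d_pt_const. }
  assert (F : continuity_2d_pt (fun x t => Re (g x t) * Im (g x t) / (2 * f x t)) x t).
  { apply continuity_2d_pt_mult; [now apply continuity_2d_pt_mult|].
    apply continuity_2d_pt_inv; [|lra]. apply continuity_2d_pt_mult; auto; apply continuity_2d_pt_const. }
  split.
  - apply (continuity_2d_pt_mult _ (fun x t => cos (Re (g x t) * Im (g x t) / (2 * f x t)))); auto.
    apply (continuity_2d_pt_comp1 cos (fun x t => Re (g x t) * Im (g x t) / (2 * f x t))); auto. apply continuous_cos.
  - apply continuity_2d_pt_opp. apply (continuity_2d_pt_mult _ (fun x t => sin (Re (g x t) * Im (g x t) / (2 * f x t)))); auto.
    apply (continuity_2d_pt_comp1 sin (fun x t => Re (g x t) * Im (g x t) / (2 * f x t))); auto. apply continuous_sin.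
Qed.

Lemma gker_continuity_2d (a b : nat) (f : R -> R -> R) (g : R -> R -> C) (x t : R) : 0 < f x t ->
  continuity_2d_pt f x t -> continuity_2d_C g x t -> continuity_2d_C (fun x t => gker a b (f x t) (g x t)) x t.
Proof.
  intros Hf Cf Cg. apply continuity_2d_C_mult.
  - split; [|exact (continuity_2d_pt_const x t 0)]. simpl.
    apply (continuity_2d_pt_comp1 (fun s => (/ sqrt s) ^ b) f); auto.
    eapply is_derive_continuous, inv_sqrt_pow_derive, Hf.
  - apply continuity_2d_C_mult; [now apply continuity_2d_C_pow|now apply gauss_continuity_2d].
Qed.

(** The derivatives in w of sg^(-1/2) exp(-w^2 / (4 sg)), up to the third: a second-order Taylor
    estimate is needed for the kernel and for its y-derivative. The last case is a default beyond j
    = 3. *)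
Definition gkernel (j : nat) (sg : R) (w : C) : C :=
  match j with
  | 0%nat => gker 0 1 sg w
  | 1%nat => RtoC (- / 2) * gker 1 3 sg w
  | 2%nat => RtoC (- / 2) * gker 0 3 sg w + RtoC (/ 4) * gker 2 5 sg w
  | _ => RtoC (3 / 4) * gker 1 5 sg w + RtoC (- / 8) * gker 3 7 sg w
  end%C.

Lemma gkernel_line_derive (j : nat) (sg : R) : (j < 3)%nat -> 0 < sg ->
  line_derive (gkernel j sg) (gkernel (S j) sg).
Proof.
  intros Hj Hs. destruct j as [|[|[|j]]]; [| | |lia].
  - eapply line_derive_ext; [now apply gker_line_derive|].
    intros w. simpl. ring.
  - eapply line_derive_ext; [apply line_derive_scal; now apply gker_line_derive|].
    intros w. simpl. replace (/ 4) with (- / 2 * - / 2) by field. rewrite RtoC_mult. ring.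
  - eapply line_derive_ext.
    + apply line_derive_plus; apply line_derive_scal; now apply gker_line_derive.
    + intros w. simpl. replace (3 / 4) with (- / 2 * - / 2 + / 4 * (1 + 1)) by field.
      replace (- / 8) with (/ 4 * - / 2) by field.
      rewrite !RtoC_plus, !RtoC_mult, !RtoC_plus. ring.
Qed.

(** Entry j + 2 is the second derivative of entry j in w, so this is the heat equation, and its
    derivative in w for j = 1. *)
Lemma gkernel_Cderive_time (j : nat) (w : C) (sg : R) : (j < 2)%nat -> 0 < sg ->
  is_Cderive (fun s => gkernel j s w) sg (gkernel (S (S j)) sg w).
Proof.
  intros Hj Hs. destruct j as [|[|j]]; [| |lia].
  - assert (H := gker_Cderive_time 0 1 w sg Hs). simpl.
    match type of H with is_Cderive _ _ ?x => match goal with |- is_Cderive _ _ ?y => replace y with x; [exact H|] end end.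
    simpl. replace (1 / 2) with (/ 2) by field. ring.
  - assert (H := is_Cderive_scal (RtoC (- / 2)) _ _ _ (gker_Cderive_time 1 3 w sg Hs)). simpl.
    match type of H with is_Cderive _ _ ?x => match goal with |- is_Cderive _ _ ?y => replace y with x; [exact H|] end end.
    simpl. replace (3 / 4) with (- / 2 * - ((1 + 1 + 1) / 2)) by field.
    replace (- / 8) with (- / 2 * / 4) by field. rewrite !RtoC_mult. ring.
Qed.

Lemma gkernel_continuity_2d (j : nat) (f : R -> R -> R) (g : R -> R -> C) (x t : R) : 0 < f x t ->
  continuity_2d_pt f x t -> continuity_2d_C g x t -> continuity_2d_C (fun x t => gkernel j (f x t) (g x t)) x t.
Proof.
  intros Hf Cf Cg. assert (G := fun a b => gker_continuity_2d a b f g x t Hf Cf Cg).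
  assert (K := fun c => continuity_2d_C_const c x t).
  destruct j as [|[|[|j]]]; simpl.
  - auto.
  - apply continuity_2d_C_mult; auto.
  - apply continuity_2d_C_plus; apply continuity_2d_C_mult; auto.
  - apply continuity_2d_C_plus; apply continuity_2d_C_mult; auto.
Qed.

Lemma line_derive_slice (f f' : C -> C) (c z : C) (y : R) : line_derive f f' ->
  is_derive (fun y => Re (c * f (z - RtoC y)%C)%C) y (Re (- c * f' (z - RtoC y)%C)%C).
Proof.
  intros H. destruct (is_Cderive_scal c _ _ _ (H z (RtoC (-1)) y)) as [D _].
  assert (E : forall t, (z + RtoC t * RtoC (-1))%C = (z - RtoC t)%C).
  { intros t. apply injective_projections; simpl; ring. }
  evar_last.
  - eapply is_derive_ext; [|exact D]. intros t. cbv beta. now rewrite E.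
  - rewrite E. f_equal. replace (RtoC (-1)) with (- RtoC 1)%C; [ring|].
    apply injective_projections; simpl; ring.
Qed.

(** The derivative of a slice is a sum of two slices with other exponents and coefficients, so the
    induction must vary a, b and c. *)
Lemma gker_slice_smooth (sg : R) (z : C) : 0 < sg -> forall n a b c,
  smooth_n n (fun y => Re (c * gker a b sg (z - RtoC y)%C)%C).
Proof.
  intros Hs n. induction n as [|n IH]; intros a b c.
  - intros y. eapply is_derive_continuous, line_derive_slice. now apply gker_line_derive.
  - eexists. split.
    + intros y. apply line_derive_slice. now apply gker_line_derive.
    + cbv beta.
      assert (P := smooth_n_plus n _ _ (IH (pred a) b (- c * RtoC (INR a))%C) (IH (S a) (b + 2)%nat (- c * RtoC (- / 2))%C)).
      match type of P with smooth_n _ ?f => match goal with |- smooth_n _ ?g => replace g with f; [exact P|] end end.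
      extensionality y. rewrite <- re_plus. f_equal. ring.
Qed.

Lemma gkernel_slice_smooth (j : nat) (sg : R) (c z : C) : 0 < sg ->
  smooth (fun y => Re (c * gkernel j sg (z - RtoC y)%C)%C).
Proof.
  intros Hs. assert (S2 : forall c1 c2 a1 b1 a2 b2,
    smooth (fun y => Re (c * (c1 * gker a1 b1 sg (z - RtoC y)%C + c2 * gker a2 b2 sg (z - RtoC y)%C))%C)).
  { intros c1 c2 a1 b1 a2 b2 n.
    assert (P := smooth_n_plus n _ _ (gker_slice_smooth sg z Hs n a1 b1 (c * c1)%C) (gker_slice_smooth sg z Hs n a2 b2 (c * c2)%C)).
    match type of P with smooth_n _ ?f => match goal with |- smooth_n _ ?g => replace g with f; [exact P|] end end.
    extensionality y. rewrite <- re_plus. f_equal. ring. }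
  destruct j as [|[|[|j]]]; cbv beta iota delta [gkernel]; auto.
  - intros n. exact (gker_slice_smooth sg z Hs n 0 1 c).
  - intros n. assert (P := gker_slice_smooth sg z Hs n 1 3 (c * RtoC (- / 2))%C).
    match type of P with smooth_n _ ?f => match goal with |- smooth_n _ ?g => replace g with f; [exact P|] end end.
    extensionality y. f_equal. ring.
Qed.

(* The factors c = 1 and c = -i give the real and the imaginary part. *)
Definition heat_kernel (tau : R) (j : nat) (c z : C) (y s : R) : R :=
  Re (c * gkernel j (tau - s) (z - RtoC y)%C)%C.

(** Each y-derivative of a function of z - y changes the sign of c, and the width tau - s reverses
    time. *)
Lemma heat_kernel_backward (tau : R) (j : nat) (c z : C) : (j < 2)%nat ->
  backward_heat tau (heat_kernel tau j c z) (heat_kernel tau (S j) (- c)%C z) (heat_kernel tau (S (S j)) c z).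
Proof.
  intros Hj s Hs. unfold heat_kernel. assert (Hts : 0 < tau - s) by lra. split.
  - now apply gkernel_slice_smooth.
  - intros y. split; [|split; [|split]].
    + apply line_derive_slice. apply gkernel_line_derive; auto; lia.
    + evar_last; [apply line_derive_slice; apply gkernel_line_derive; auto; lia|].
      f_equal. ring.
    + destruct (is_Cderive_scal c _ _ _ (gkernel_Cderive_time j (z - RtoC y)%C (tau - s) Hj Hts)) as [D _].
      evar_last.
      * apply (is_derive_comp (fun s => Re (c * gkernel j s (z - RtoC y)%C)%C) (fun s => tau - s) s); [exact D|].
        auto_derive; auto.
      * unfold scal; simpl; unfold mult; simpl. ring.
    + assert (G : forall i c, continuity_2d_pt (fun y s => Re (c * gkernel i (tau - s) (z - RtoC y)%C)%C) y s).
      { intros i c'. apply (continuity_2d_C_mult (fun _ _ => c') (fun y s => gkernel i (tau - s) (z - RtoC y)%C)).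
        - apply continuity_2d_C_const.
        - apply (gkernel_continuity_2d i (fun _ s => tau - s) (fun y _ => z - RtoC y)%C); auto.
          + apply continuity_2d_pt_minus; [apply continuity_2d_pt_const|apply continuity_2d_pt_id2].
          + split; simpl.
            * apply (continuity_2d_pt_plus (fun _ _ => fst z) (fun y _ => - y)); [apply continuity_2d_pt_const|].
              apply (continuity_2d_pt_opp (fun y _ => y)), continuity_2d_pt_id1.
            * apply continuity_2d_pt_const. }
      split; [|split]; apply G.
Qed.

(** * Bounds on the kernel *)

Lemma Cmod_gker (a b : nat) (sg : R) (w : C) : 0 < sg ->
  Cmod (gker a b sg w) = (/ sqrt sg) ^ b * (Cmod w ^ a * exp (- (Re w ^ 2 - Im w ^ 2) / (4 * sg))).
Proof.
  intros Hs. unfold gker. rewrite !Cmod_mult, Cmod_R, Cmod_pow, Cmod_gauss. f_equal.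
  apply Rabs_pos_eq, pow_le. left. now apply Rinv_0_lt_compat, sqrt_lt_R0.
Qed.

Lemma exp_le (x y : R) : x <= y -> exp x <= exp y.
Proof. intros [H|H]; [left; now apply exp_increasing|rewrite H; lra]. Qed.

(* Where the kernel stays bounded: either Re w^2 >= c, so that the Gaussian beats
   every power of the vanishing width, or the width is frozen. *)
Definition admissible (c sg0 : R) (w : C) (sg : R) : Prop :=
  0 < sg /\ Cmod w <= 3 /\ (c <= Re w ^ 2 - Im w ^ 2 \/ sg = sg0).

Lemma gker_bounded (c sg0 : R) (a b : nat) : 0 < c -> 0 < sg0 ->
  exists M, 0 <= M /\ forall w sg, admissible c sg0 w sg -> Cmod (gker a b sg w) <= M.
Proof.
  intros Hc Hsg0. destruct (pow_exp_neg_bound (c / 4) b) as [C [PC HC]]; [lra|].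
  assert (P3 : 0 <= 3 ^ a) by (apply pow_le; lra).
  assert (B1 : 0 <= 3 ^ a * (1 + C)) by (apply Rmult_le_pos; lra).
  assert (Q : 0 <= (/ sqrt sg0) ^ b).
  { apply pow_le. left. now apply Rinv_0_lt_compat, sqrt_lt_R0. }
  assert (B2 : 0 <= (/ sqrt sg0) ^ b * (3 ^ a * exp (9 / (4 * sg0)))).
  { apply Rmult_le_pos; auto. apply Rmult_le_pos; auto. left; apply exp_pos. }
  exists (3 ^ a * (1 + C) + (/ sqrt sg0) ^ b * (3 ^ a * exp (9 / (4 * sg0)))). split; [lra|].
  intros w sg [Hs [Hw H]]. rewrite Cmod_gker by auto.
  assert (Hwa : Cmod w ^ a <= 3 ^ a) by (apply pow_incr; split; auto; apply Cmod_ge_0).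
  assert (Hwa0 : 0 <= Cmod w ^ a) by apply pow_le, Cmod_ge_0.
  assert (Pi := Rinv_0_lt_compat _ Hs).
  assert (Pr : 0 < / sqrt sg) by now apply Rinv_0_lt_compat, sqrt_lt_R0.
  assert (Pb : 0 <= (/ sqrt sg) ^ b) by (apply pow_le; lra).
  destruct H as [H|H].
  - assert (E : exp (- (Re w ^ 2 - Im w ^ 2) / (4 * sg)) <= exp (- (c / 4 * / sg))).
    { apply exp_le. replace (- (Re w ^ 2 - Im w ^ 2) / (4 * sg)) with (- ((Re w ^ 2 - Im w ^ 2) / 4 * / sg)) by (field; lra).
      apply Ropp_le_contravar, Rmult_le_compat_r; lra. }
    (* Replaces half-integer powers of 1 / sg by integer ones, to which [pow_exp_neg_bound]
       applies. *)
    assert (R : (/ sqrt sg) ^ b <= 1 + (/ sg) ^ b).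
    { rewrite <- (inv_sqrt_sq sg Hs), <- pow_mult.
      assert (X : 0 <= (/ sqrt sg) ^ (2 * b)) by (apply pow_le; lra).
      destruct (Rle_dec (/ sqrt sg) 1).
      - assert ((/ sqrt sg) ^ b <= 1 ^ b) by (apply pow_incr; lra). rewrite pow1 in H0. lra.
      - assert ((/ sqrt sg) ^ b <= (/ sqrt sg) ^ (2 * b)) by (apply Rle_pow; [lra|lia]). lra. }
    assert (HC' := HC (/ sg) ltac:(lra)).
    assert (E1 : exp (- (c / 4 * / sg)) <= 1).
    { rewrite <- exp_0. apply exp_le. assert (0 <= c / 4 * / sg) by (apply Rmult_le_pos; lra). lra. }
    assert (E0 : 0 < exp (- (c / 4 * / sg))) by apply exp_pos.
    apply Rle_trans with (3 ^ a * (1 + C)); [|lra].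
    apply Rle_trans with ((/ sqrt sg) ^ b * (3 ^ a * exp (- (c / 4 * / sg)))).
    + apply Rmult_le_compat_l; auto. apply Rmult_le_compat; auto. left; apply exp_pos.
    + replace ((/ sqrt sg) ^ b * (3 ^ a * exp (- (c / 4 * / sg)))) with
        (3 ^ a * ((/ sqrt sg) ^ b * exp (- (c / 4 * / sg)))) by ring.
      apply Rmult_le_compat_l; auto.
      apply Rle_trans with ((1 + (/ sg) ^ b) * exp (- (c / 4 * / sg))); [|lra].
      apply Rmult_le_compat_r; lra.
  - subst sg0. apply Rle_trans with ((/ sqrt sg) ^ b * (3 ^ a * exp (9 / (4 * sg)))); [|lra].
    apply Rmult_le_compat_l; auto. apply Rmult_le_compat; auto; [left; apply exp_pos|].
    apply exp_le. unfold Rdiv. apply Rmult_le_compat_r; [left; apply Rinv_0_lt_compat; lra|].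
    assert (M : Re w ^ 2 + Im w ^ 2 <= 9).
    { replace (Re w ^ 2 + Im w ^ 2) with (Cmod w ^ 2).
      - replace 9 with (3 ^ 2) by ring. apply pow_incr. split; auto. apply Cmod_ge_0.
      - unfold Cmod. rewrite <- Rsqr_pow2, Rsqr_sqrt; auto. assert (X := pow2_ge_0 (fst w)). assert (Y := pow2_ge_0 (snd w)). lra. }
    assert (X := pow2_ge_0 (Re w)). lra.
Qed.

Lemma gkernel_bounded (c sg0 : R) : 0 < c -> 0 < sg0 ->
  exists M, 0 < M /\ forall j w sg, admissible c sg0 w sg -> Cmod (gkernel j sg w) <= M.
Proof.
  intros Hc Hs.
  assert (S2 : forall c1 c2 a1 b1 a2 b2, exists M, 0 <= M /\ forall w sg, admissible c sg0 w sg ->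
    Cmod (c1 * gker a1 b1 sg w + c2 * gker a2 b2 sg w)%C <= M).
  { intros c1 c2 a1 b1 a2 b2.
    destruct (gker_bounded c sg0 a1 b1 Hc Hs) as [M1 [P1 H1]].
    destruct (gker_bounded c sg0 a2 b2 Hc Hs) as [M2 [P2 H2]].
    assert (Q1 := Cmod_ge_0 c1). assert (Q2 := Cmod_ge_0 c2).
    exists (Cmod c1 * M1 + Cmod c2 * M2). split.
    - apply Rplus_le_le_0_compat; now apply Rmult_le_pos.
    - intros w sg A. eapply Rle_trans; [apply Cmod_triangle|]. rewrite !Cmod_mult.
      apply Rplus_le_compat; apply Rmult_le_compat_l; auto. }
  destruct (S2 (RtoC 1) (RtoC 0) 0 1 0 1)%nat as [M0 [P0 H0]].
  destruct (S2 (RtoC (- / 2)) (RtoC 0) 1 3 0 1)%nat as [M1 [P1 H1]].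
  destruct (S2 (RtoC (- / 2)) (RtoC (/ 4)) 0 3 2 5)%nat as [M2 [P2 H2]].
  destruct (S2 (RtoC (3 / 4)) (RtoC (- / 8)) 1 5 3 7)%nat as [M3 [P3 H3]].
  exists (M0 + M1 + M2 + M3 + 1). split; [lra|].
  intros j w sg A. specialize (H0 w sg A). specialize (H1 w sg A). specialize (H2 w sg A). specialize (H3 w sg A).
  rewrite Cmult_0_l, Cplus_0_r in H0, H1. rewrite Cmult_1_l in H0.
  destruct j as [|[|[|j]]]; cbv beta iota delta [gkernel]; lra.
Qed.

Lemma Re_mult_le (c w : C) : Rabs (Re (c * w)%C) <= Cmod c * Cmod w.
Proof. rewrite <- Cmod_mult. apply re_le_Cmod. Qed.

(** The mean value theorem fails for complex values; it is applied twice to the real functions Re (c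
    f) and Re (c h f') along the segment from w to w + h. *)
Lemma line_derive_taylor (f f' f'' : C -> C) (w h c : C) (M : R) :
  line_derive f f' -> line_derive f' f'' ->
  (forall t, 0 <= t <= 1 -> Cmod (f'' (w + RtoC t * h)%C) <= M) ->
  Rabs (Re (c * (f (w + h) - f w - h * f' w))%C) <= Cmod c * M * Cmod h ^ 2.
Proof.
  intros Hf Hf' HM.
  set (p := fun t => Re (c * f (w + RtoC t * h))%C).
  set (q := fun t => Re (c * h * f' (w + RtoC t * h))%C).
  assert (Dp : forall t, is_derive p t (q t)).
  { intros t. destruct (is_Cderive_scal c _ _ _ (Hf w h t)) as [D _]. unfold p, q.
    evar_last; [exact D|]. f_equal. ring. }
  assert (Dq : forall t, is_derive q t (Re (c * h ^ 2 * f'' (w + RtoC t * h))%C)).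
  { intros t. destruct (is_Cderive_scal (c * h)%C _ _ _ (Hf' w h t)) as [D _]. unfold q.
    evar_last; [exact D|]. f_equal. simpl. ring. }
  destruct (MVT_gen p 0 1 q) as [s [Hs Es]].
  { intros; apply Dp. }
  { intros x _. apply continuity_pt_filterlim. eapply is_derive_continuous, Dp. }
  rewrite Rmin_left, Rmax_right in Hs by lra.
  destruct (MVT_gen q 0 s (fun t => Re (c * h ^ 2 * f'' (w + RtoC t * h))%C)) as [t [Ht Et]].
  { intros; apply Dq. }
  { intros x _. apply continuity_pt_filterlim. eapply is_derive_continuous, Dq. }
  rewrite Rmin_left, Rmax_right in Ht by lra.
  assert (E0 : forall g : C -> C, g (w + RtoC 0 * h)%C = g w) by (intros g; f_equal; ring).
  replace (Re (c * (f (w + h) - f w - h * f' w))%C) with (p 1 - p 0 - q 0).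
  2:{ unfold p, q. rewrite !E0, Cmult_1_l.
      replace (c * (f (w + h) - f w - h * f' w))%C with (c * f (w + h) + - (c * f w) + - (c * h * f' w))%C by ring.
      rewrite !re_plus, !re_opp. reflexivity. }
  rewrite Es. replace (q s * (1 - 0) - q 0) with (q s - q 0) by ring. rewrite Et, Rabs_mult.
  apply Rle_trans with (Cmod (c * h ^ 2) * Cmod (f'' (w + RtoC t * h)%C) * Rabs (s - 0)).
  { apply Rmult_le_compat_r; [apply Rabs_pos|]. apply Re_mult_le. }
  rewrite Cmod_mult, Cmod_pow. rewrite Rminus_0_r, Rabs_pos_eq by lra.
  assert (Q : Cmod (f'' (w + RtoC t * h)%C) <= M) by (apply HM; lra).
  assert (Pc := Cmod_ge_0 c). assert (Pf := Cmod_ge_0 (f'' (w + RtoC t * h)%C)).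
  assert (Ph : 0 <= Cmod h ^ 2) by apply pow2_ge_0.
  replace (Cmod c * M * Cmod h ^ 2) with (Cmod c * Cmod h ^ 2 * M * 1) by ring.
  assert (Pch : 0 <= Cmod c * Cmod h ^ 2) by now apply Rmult_le_pos.
  apply Rmult_le_compat; try lra.
  - now apply Rmult_le_pos.
  - now apply Rmult_le_compat_l.
Qed.

(* The square |x| + |y| < r is exactly where Re (z - y)^2 > 0 for all real y with |y| >= r. *)
Lemma square_admissible (r e sg0 sg : R) (z : C) (y : R) : 0 < e -> r <= 1 ->
  Rabs (Re z) + Rabs (Im z) <= r - e -> Rabs y < 1 -> 0 < sg -> (r <= Rabs y \/ sg = sg0) ->
  admissible (e ^ 2) sg0 (z - RtoC y)%C sg.
Proof.
  intros He Hr Hz Hy Hs H. destruct z as [p v]. unfold Re, Im in *. simpl in Hz.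
  assert (Pp := Rabs_pos p). assert (Pv := Rabs_pos v).
  split; [auto|split].
  - eapply Rle_trans; [apply Cmod_triangle|]. rewrite Cmod_opp, Cmod_R.
    assert (Cmod (p, v) <= Rabs p + Rabs v).
    { replace (p, v) with (RtoC p + RtoC v * Ci)%C by (apply injective_projections; simpl; ring).
      eapply Rle_trans; [apply Cmod_triangle|]. rewrite Cmod_mult, !Cmod_R.
      replace (Cmod Ci) with 1; [lra|]. unfold Cmod, Ci; simpl. symmetry.
      replace (0 * (0 * 1) + 1 * (1 * 1)) with 1 by ring. apply sqrt_1. }
    lra.
  - destruct H as [H|H]; [left|now right]. unfold Re, Im; simpl.
    (* From |y| >= r and |p| + |v| <= r - e; squaring gives (p - y)^2 - v^2 >= e^2. *)
    assert (X : Rabs v + e <= Rabs (p - y)).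
    { assert (Y := Rabs_triang_inv y p). rewrite Rabs_minus_sym in Y. lra. }
    replace (p + - y) with (p - y) by ring. replace (v + - 0) with v by ring.
    rewrite Rmult_1_r. rewrite Rmult_1_r. rewrite Rmult_1_r.
    assert (E1 : Rabs (p - y) * Rabs (p - y) = (p - y) * (p - y)).
    { rewrite <- Rabs_mult. apply Rabs_pos_eq. apply Rle_0_sqr. }
    assert (E2 : Rabs v * Rabs v = v * v).
    { rewrite <- Rabs_mult. apply Rabs_pos_eq. apply Rle_0_sqr. }
    rewrite <- E1, <- E2. nra.
Qed.

(** * The holomorphic limit *)

Definition l1norm (z : C) : R := Rabs (Re z) + Rabs (Im z).

Lemma l1norm_plus (z h : C) : l1norm (z + h)%C <= l1norm z + 2 * Cmod h.
Proof.
  unfold l1norm. rewrite re_plus, im_plus.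
  assert (A1 := Rabs_triang (Re z) (Re h)). assert (A2 := Rabs_triang (Im z) (Im h)).
  assert (B := Rmax_Cmod h). unfold Re, Im in *.
  assert (B1 := Rmax_l (Rabs (fst h)) (Rabs (snd h))). assert (B2 := Rmax_r (Rabs (fst h)) (Rabs (snd h))). lra.
Qed.

Lemma heat_kernel_bounded (tau r : R) (z : C) : 0 < tau -> r <= 1 -> l1norm z < r ->
  exists M, 0 < M /\ forall j h y s, 4 * Cmod h <= r - l1norm z -> Rabs y < 1 -> s < tau ->
    (r <= Rabs y \/ s = tau / 2) -> Cmod (gkernel j (tau - s) (z + h - RtoC y)%C) <= M.
Proof.
  (* Adding h raises [l1norm] by at most 2 |h|, which the factor 4 limits to half of the gap r -
     [l1norm z]; the other half is e. The bound is thus uniform in h. *)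
  intros Ht Hr Hz. set (e := (r - l1norm z) / 2). assert (He : 0 < e) by (unfold e; lra).
  assert (He2 : 0 < e ^ 2) by (apply pow_lt; auto).
  destruct (gkernel_bounded (e ^ 2) (tau / 2) He2) as [M [PM HM]]; [lra|].
  exists M. split; auto. intros j h y s Hh Hy Hs H. apply HM.
  apply (square_admissible r e); auto; [|lra|].
  - assert (L := l1norm_plus z h). unfold l1norm in L at 1. unfold e. lra.
  - destruct H as [H|H]; [now left|right; lra].
Qed.

Lemma Rabs_heat_kernel (tau : R) (j : nat) (c z : C) (y s : R) :
  Rabs (heat_kernel tau j c z y s) <= Cmod c * Cmod (gkernel j (tau - s) (z - RtoC y)%C).
Proof. apply Re_mult_le. Qed.

Lemma heat_kernel_lin (tau a b : R) (j : nat) (c d z : C) (y s : R) :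
  heat_kernel tau j (RtoC a * c + RtoC b * d)%C z y s =
  a * heat_kernel tau j c z y s + b * heat_kernel tau j d z y s.
Proof.
  unfold heat_kernel. rewrite <- !re_scal_l, <- re_plus. f_equal. ring.
Qed.

Definition cutoff (r : R) (chi : R -> R) : Prop :=
  smooth chi /\ supported chi (-1) 1 /\ forall y, Rabs y <= r -> chi y = 1.

(** With rho = (1 + r) / 2, the function rises on (-rho, -r) and, the shift being r + rho, descends
    on (r, rho). Dividing by the mass of the bump makes the height 1. *)
Definition cutoff_fun (r y : R) : R :=
  / RInt (bump (- ((1 + r) / 2)) (- r)) (- ((1 + r) / 2)) (- r) *
  plateau (- ((1 + r) / 2)) (- r) (r + (1 + r) / 2) y.

Lemma cutoff_fun_cutoff (r : R) : 0 < r < 1 -> cutoff r (cutoff_fun r).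
Proof.
  intros Hr. unfold cutoff_fun. set (rho := (1 + r) / 2).
  set (I := RInt (bump (- rho) (- r)) (- rho) (- r)).
  assert (HI : 0 < I) by (apply bump_mass_pos; unfold rho; lra).
  split; [|split].
  - apply smooth_mult; [apply smooth_const|apply smooth_plateau].
  - exists (- rho), rho. split; [unfold rho; lra|]. split; [unfold rho; lra|]. intros y Hy.
    rewrite plateau_out; [ring|unfold rho; lra|unfold rho; lra|].
    destruct (Rle_dec y (- rho)); [now left|right; unfold rho in *; lra].
  - intros y Hy. apply Rabs_le_between in Hy.
    rewrite plateau_in; [fold I; field; lra|unfold rho; lra|unfold rho; lra|unfold rho; lra].
Qed.

Section Extension.

Context (T tau : R) (u : R -> R -> R) (Hu : weak_heat T u) (Htau : 0 < tau < T).

Lemma localized_lin (chi : R -> R) (k l : R -> R -> R) (a b s : R) : smooth chi -> supported chi (-1) 1 ->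
  0 < s < T -> smooth (fun y => k y s) -> smooth (fun y => l y s) ->
  localized u chi (fun y s => a * k y s + b * l y s) s = a * localized u chi k s + b * localized u chi l s.
Proof.
  intros Sc Pc Hs Sk Sl. unfold localized, pairing.
  assert (I : forall k, smooth (fun y => k y s) -> ex_RInt (fun y => chi y * k y s * u y s) (-1) 1).
  { intros k' Sk'. apply (ex_RInt_weak_heat T u Hu (fun y => chi y * k' y s)); auto.
    - intros x. apply smooth_continuous. now apply smooth_mult.
    - now apply supported_mult. }
  rewrite <- !RInt_Rscal by auto. rewrite <- RInt_Rplus.
  - apply RInt_ext. intros y _. Rring.
  - apply (@ex_RInt_scal R_NormedModule). auto.
  - apply (@ex_RInt_scal R_NormedModule). auto.
Qed.

Definition kernel_limit (chi : R -> R) (j : nat) (c z : C) : R :=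
  real (Lim_seq (fun n => localized u chi (heat_kernel tau j c z) (approach tau n))).

Context (r : R) (Hr : r <= 1) (chi : R -> R) (Hchi : cutoff r chi).

Lemma kernel_limit_correct (j : nat) (c z : C) : (j < 2)%nat -> l1norm z < r ->
  is_lim_seq (fun n => localized u chi (heat_kernel tau j c z) (approach tau n)) (kernel_limit chi j c z).
Proof.
  intros Hj Hz. destruct Hchi as [Sc [Pc Ec]].
  destruct (heat_kernel_bounded tau r z) as [M [PM HM]]; auto; [lra|].
  apply Lim_seq_correct'.
  apply (localized_cvg T tau u Hu Htau chi Sc Pc r Ec _ _ _ (Cmod c * M)
    ltac:(apply Rmult_le_pos; [apply Cmod_ge_0|lra]) (heat_kernel_backward tau j c z Hj)).
  intros y s Hy Hs.
  assert (B : forall j, Cmod (gkernel j (tau - s) (z - RtoC y)%C) <= M).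
  { intros i. replace (z - RtoC y)%C with (z + RtoC 0 - RtoC y)%C by ring.
    apply HM; try lra. rewrite Cmod_0. lra. }
  split; (eapply Rle_trans; [apply Rabs_heat_kernel|]); rewrite ?Cmod_opp; apply Rmult_le_compat_l; auto; apply Cmod_ge_0.
Qed.

Lemma approach_in (n : nat) : 0 < approach tau n < tau.
Proof. destruct Htau as [H1 H2]. assert (A := approach_bounds T tau Htau n). lra. Qed.

(** Real linearity in c turns a factor h inside the kernel into a complex product of the limits, by
    decomposing c h along 1 and -i. *)
Lemma kernel_limit_lin (j : nat) (a b : R) (c d z : C) : (j < 2)%nat -> l1norm z < r ->
  kernel_limit chi j (RtoC a * c + RtoC b * d)%C z = a * kernel_limit chi j c z + b * kernel_limit chi j d z.
Proof.
  intros Hj Hz.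
  assert (L := kernel_limit_correct j (RtoC a * c + RtoC b * d)%C z Hj Hz).
  assert (L1 := kernel_limit_correct j c z Hj Hz). assert (L2 := kernel_limit_correct j d z Hj Hz).
  assert (L' := is_lim_seq_plus' _ _ _ _ (is_lim_seq_scal_l _ a _ L1) (is_lim_seq_scal_l _ b _ L2)).
  apply is_lim_seq_unique in L. apply (is_lim_seq_ext _ (fun n => localized u chi (heat_kernel tau j (RtoC a * c + RtoC b * d)%C z) (approach tau n))) in L'.
  - apply is_lim_seq_unique in L'. rewrite L in L'. now inversion L'.
  - intros n. destruct Hchi as [Sc [Pc Ec]]. assert (A := approach_in n).
    rewrite <- localized_lin; auto; try lra.
    + unfold localized, pairing. apply RInt_ext. intros y _. now rewrite heat_kernel_lin.
    + now apply (heat_kernel_backward tau j c z Hj).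
    + now apply (heat_kernel_backward tau j d z Hj).
Qed.

(** The Taylor remainder of the kernel is a backward solution to which [localized_bounded] applies
    with M of order |h|^2, uniformly along the sequence of times. *)
Lemma kernel_limit_remainder (z : C) : l1norm z < r -> exists A, 0 < A /\
  forall c h, 4 * Cmod h <= r - l1norm z ->
    Rabs (kernel_limit chi 0 c (z + h)%C - kernel_limit chi 0 c z - kernel_limit chi 1 (c * h)%C z) <= A * Cmod c * Cmod h ^ 2.
Proof.
  intros Hz. destruct Hchi as [Sc [Pc Ec]].
  destruct (heat_kernel_bounded tau r z) as [M [PM HM]]; auto; [lra|].
  destruct (localized_bounded T tau u Hu Htau chi Sc Pc r Ec) as [A [PA HA]].
  exists (A * M). split; [now apply Rmult_lt_0_compat|].
  intros c h Hh.
  assert (Hzh : l1norm (z + h)%C < r) by (assert (L := l1norm_plus z h); lra).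
  assert (L1 := kernel_limit_correct 0 c (z + h)%C ltac:(lia) Hzh).
  assert (L2 := kernel_limit_correct 0 c z ltac:(lia) Hz).
  assert (L3 := kernel_limit_correct 1 (c * h)%C z ltac:(lia) Hz).
  assert (L := is_lim_seq_minus' _ _ _ _ (is_lim_seq_minus' _ _ _ _ L1 L2) L3).
  apply is_lim_seq_abs in L.
  apply (is_lim_seq_le _ (fun _ => A * M * Cmod c * Cmod h ^ 2) _ (A * M * Cmod c * Cmod h ^ 2)) in L; auto.
  2:{ apply is_lim_seq_const. }
  intros n. assert (An := approach_in n).
  assert (K1 := heat_kernel_backward tau 0 c (z + h)%C ltac:(lia)).
  assert (K2 := heat_kernel_backward tau 0 c z ltac:(lia)).
  assert (K3 := heat_kernel_backward tau 1 (c * h)%C z ltac:(lia)).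
  assert (K12 := backward_heat_lin tau 1 (-1) _ _ _ _ _ _ K1 K2).
  assert (K := backward_heat_lin tau 1 (-1) _ _ _ _ _ _ K12 K3).
  assert (HP : 0 <= Cmod c * M * Cmod h ^ 2).
  { apply Rmult_le_pos; [apply Rmult_le_pos; [apply Cmod_ge_0|lra]|apply pow2_ge_0]. }
  specialize (HA _ _ _ _ HP K).
  assert (Seg : forall t, 0 <= t <= 1 -> 4 * Cmod (RtoC t * h)%C <= r - l1norm z).
  { intros t Ht. rewrite Cmod_mult, Cmod_R, Rabs_pos_eq by lra. assert (P := Cmod_ge_0 h). nra. }
  (* Index 0 bounds the remainder, index 1 its y-derivative, whose coefficient is -c; hence the
     general c' of the same modulus. *)
  assert (Ta : forall i c' y s, (i < 2)%nat -> Rabs y < 1 -> s < tau -> (r <= Rabs y \/ s = tau / 2) -> Cmod c' = Cmod c ->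
    Rabs (1 * (1 * heat_kernel tau i c' (z + h)%C y s + -1 * heat_kernel tau i c' z y s) +
      -1 * heat_kernel tau (S i) (c' * h)%C z y s) <= Cmod c * M * Cmod h ^ 2).
  { intros i c' y s Hi Hy Hs Hd Hc'. rewrite <- Hc'.
    assert (Hts : 0 < tau - s) by lra.
    assert (Q := line_derive_taylor _ _ _ (z - RtoC y)%C h c' M
      (gkernel_line_derive i (tau - s) ltac:(lia) Hts) (gkernel_line_derive (S i) (tau - s) ltac:(lia) Hts)).
    match goal with |- Rabs ?x <= _ => match type of Q with _ -> Rabs ?y <= _ => replace x with y end end.
    - apply Q. intros t Ht. replace (z - RtoC y + RtoC t * h)%C with (z + RtoC t * h - RtoC y)%C by ring.
      apply HM; auto.
    - unfold heat_kernel.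
      replace (z + h - RtoC y)%C with (z - RtoC y + h)%C by ring.
      match goal with |- Re (_ * (?x - ?y - _ * ?w))%C = _ =>
        replace (c' * (x - y - h * w))%C with (c' * x + - (c' * y) + - (c' * h * w))%C by ring end.
      rewrite !re_plus, !re_opp. ring. }
  assert (HA' : Rabs (localized u chi (fun y s => 1 * (1 * heat_kernel tau 0 c (z + h)%C y s + -1 * heat_kernel tau 0 c z y s) +
      -1 * heat_kernel tau 1 (c * h)%C z y s) (approach tau n)) <= A * (Cmod c * M * Cmod h ^ 2)).
  { apply HA.
    - intros y s Hy Hs. split; [apply Ta; auto; lra|].
      replace (- (c * h))%C with (- c * h)%C by ring.
      apply Ta; auto; try lra. apply Cmod_opp.
    - intros y Hy. apply Ta; auto; lra. }
  replace (A * M * Cmod c * Cmod h ^ 2) with (A * (Cmod c * M * Cmod h ^ 2)) by ring.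
  eapply Rle_trans; [|exact HA']. right. f_equal.
  assert (S1 := proj1 (K1 _ An)). assert (S2 := proj1 (K2 _ An)). assert (S3 := proj1 (K3 _ An)). assert (S12 := proj1 (K12 _ An)).
  rewrite (localized_lin chi (fun y s => 1 * heat_kernel tau 0 c (z + h)%C y s + -1 * heat_kernel tau 0 c z y s)); auto; try lra.
  rewrite localized_lin; auto; try lra.
Qed.

Definition extension (z : C) : C := (kernel_limit chi 0 (RtoC 1) z, kernel_limit chi 0 (- Ci)%C z).
Definition extension' (z : C) : C := (kernel_limit chi 1 (RtoC 1) z, kernel_limit chi 1 (- Ci)%C z).

Lemma Cmod_le_components (z : C) (M : R) : Rabs (Re z) <= M -> Rabs (Im z) <= M -> Cmod z <= 2 * M.
Proof.
  intros H1 H2. eapply Rle_trans; [apply Cmod_2Rmax|].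
  assert (S2 : sqrt 2 <= 2).
  { rewrite <- (sqrt_pow2 2) at 2 by lra. apply sqrt_le_1_alt. lra. }
  apply Rmult_le_compat; auto; [apply sqrt_pos|apply (Rle_trans _ _ _ (Rabs_pos (fst z))), Rmax_l|].
  now apply Rmax_lub.
Qed.

Lemma extension_remainder (z : C) : l1norm z < r -> exists A, 0 < A /\
  forall h, 4 * Cmod h <= r - l1norm z ->
    Cmod (extension (z + h)%C - extension z - h * extension' z)%C <= A * Cmod h ^ 2.
Proof.
  intros Hz. destruct (kernel_limit_remainder z Hz) as [A [PA HA]].
  exists (2 * A). split; [lra|]. intros h Hh. rewrite Rmult_assoc.
  assert (Ci1 : Cmod (- Ci)%C = 1).
  { rewrite Cmod_opp. unfold Cmod, Ci; simpl. replace (0 * (0 * 1) + 1 * (1 * 1)) with 1 by ring. apply sqrt_1. }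
  apply Cmod_le_components.
  - assert (H := HA (RtoC 1) h Hh). rewrite Cmod_1, Rmult_1_r in H.
    eapply Rle_trans; [|exact H]. right. f_equal.
    (* The limits at 1 and -i are the components of [extension'], so this combination is the real
       part of h times [extension']. *)
    replace (RtoC 1 * h)%C with (RtoC (Re h) * RtoC 1 + RtoC (- Im h) * (- Ci))%C
      by (apply injective_projections; unfold Re, Im; simpl; ring).
    rewrite kernel_limit_lin; auto. unfold extension, extension', Re, Im; simpl. ring.
  - assert (H := HA (- Ci)%C h Hh). rewrite Ci1, Rmult_1_r in H.
    eapply Rle_trans; [|exact H]. right. f_equal.
    replace (- Ci * h)%C with (RtoC (Im h) * RtoC 1 + RtoC (Re h) * (- Ci))%C
      by (apply injective_projections; unfold Re, Im; simpl; ring).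
    rewrite kernel_limit_lin; auto. unfold extension, extension', Re, Im; simpl. ring.
Qed.

End Extension.

Lemma is_derive_C_quadratic (f : C -> C) (z l : C) (d A : R) : 0 < d -> 0 < A ->
  (forall h, Cmod h < d -> Cmod (f (z + h) - f z - h * l)%C <= A * Cmod h ^ 2) ->
  is_derive (K := C_AbsRing) (V := C_NormedModule) f z l.
Proof.
  intros Hd HA H. split; [apply is_linear_scal_l|].
  intros z' Hz'. rewrite <- (@is_filter_lim_locally_unique C_AbsRing (AbsRing_NormedModule C_AbsRing) _ _ Hz').
  intros eps. assert (Pe := cond_pos eps).
  assert (P : 0 < Rmin d (eps / A)) by (apply Rmin_glb_lt; auto; now apply Rdiv_lt_0_compat).
  exists (mkposreal _ P). intros w Hw.
  change (Cmod (w - z)%C < Rmin d (eps / A)) in Hw.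
  change (Cmod (f w - f z - (w - z) * l)%C <= eps * Cmod (w - z)%C).
  assert (W1 := Rmin_l d (eps / A)). assert (W2 := Rmin_r d (eps / A)).
  set (h := (w - z)%C) in *. replace w with (z + h)%C by (unfold h; ring).
  eapply Rle_trans; [apply H; lra|].
  replace (A * Cmod h ^ 2) with (A * Cmod h * Cmod h) by ring.
  apply Rmult_le_compat_r; [apply Cmod_ge_0|].
  replace (pos eps) with (A * (eps / A)) by (field; lra).
  apply Rmult_le_compat_l; lra.
Qed.

(** * Independence of the cutoff, and the values on the real line *)

(** [gker 0 3] is 1 / sg times the kernel [gker 0 1], and it is bounded as well. *)
Lemma gkernel0_small (c sg0 : R) : 0 < c -> 0 < sg0 -> exists M, 0 < M /\
  forall w sg, admissible c sg0 w sg -> Cmod (gkernel 0 sg w) <= M * sg.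
Proof.
  intros Hc Hs. destruct (gker_bounded c sg0 0 3 Hc Hs) as [M [PM HM]].
  exists (M + 1). split; [lra|]. intros w sg A. specialize (HM w sg A).
  destruct A as [Hsg _]. cbv beta iota delta [gkernel]. rewrite Cmod_gker in * by auto.
  replace ((/ sqrt sg) ^ 3) with (/ sg * (/ sqrt sg) ^ 1) in HM by (rewrite <- inv_sqrt_sq by auto; ring).
  set (X := (/ sqrt sg) ^ 1 * _). apply Rle_trans with (M * sg); [|nra].
  replace X with (/ sg * (/ sqrt sg) ^ 1 * (Cmod w ^ 0 * exp (- (Re w ^ 2 - Im w ^ 2) / (4 * sg))) * sg).
  - apply Rmult_le_compat_r; lra.
  - unfold X. field. split; [apply Rgt_not_eq, sqrt_lt_R0; auto|lra].
Qed.

Lemma supported_minus (f g : R -> R) (a b : R) : supported f a b -> supported g a b ->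
  supported (fun x => f x - g x) a b.
Proof.
  intros [c [d [Hc [Hd H]]]] [c' [d' [Hc' [Hd' H']]]].
  exists (Rmin c c'), (Rmax d d'). split; [now apply Rmin_glb_lt|]. split; [now apply Rmax_lub_lt|].
  intros x Hx. rewrite H, H'; [ring| |]; intros [H1 H2]; apply Hx; split.
  - eapply Rle_trans; [apply Rmin_r|]; eauto.
  - eapply Rle_trans; [|apply Rmax_r]; eauto.
  - eapply Rle_trans; [apply Rmin_l|]; eauto.
  - eapply Rle_trans; [|apply Rmax_l]; eauto.
Qed.

Lemma approach_gap_lim (tau M : R) : is_lim_seq (fun n => M * (tau - approach tau n)) 0.
Proof.
  replace (Finite 0) with (Rbar_mult M (Finite (tau - tau))) by (simpl; f_equal; ring).
  apply is_lim_seq_scal_l. apply is_lim_seq_minus'; [apply is_lim_seq_const|apply approach_lim].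
Qed.

(* The kernel tends to 0 off the region where two cutoffs agree, so the limit
   does not see the cutoff; this glues the local extensions. *)
Lemma kernel_limit_cutoff_indep (T tau r : R) (u : R -> R -> R) (chi1 chi2 : R -> R) (c z : C) :
  weak_heat T u -> 0 < tau < T -> r <= 1 -> cutoff r chi1 -> cutoff r chi2 -> l1norm z < r ->
  kernel_limit tau u chi1 0 c z = kernel_limit tau u chi2 0 c z.
Proof.
  intros Hu Ht Hr H1 H2 Hz.
  assert (L1 := kernel_limit_correct T tau u Hu Ht r Hr chi1 H1 0 c z ltac:(lia) Hz).
  assert (L2 := kernel_limit_correct T tau u Hu Ht r Hr chi2 H2 0 c z ltac:(lia) Hz).
  destruct H1 as [S1 [P1 E1]]. destruct H2 as [S2 [P2 E2]].
  set (e := (r - l1norm z) / 2). assert (He : 0 < e) by (unfold e; lra).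
  destruct (gkernel0_small (e ^ 2) tau) as [M [PM HM]]; [now apply pow_lt|lra|].
  set (f := fun y => chi1 y - chi2 y).
  assert (Cf : forall y, continuous f y).
  { intros y. apply (continuous_minus chi1 chi2); now apply smooth_continuous. }
  assert (Pf : supported f (-1) 1) by now apply supported_minus.
  destruct (pairing_mass_bounded T tau u Hu Ht f (tau / 2)) as [A [PA HA]]; auto; [lra|].
  assert (L := is_lim_seq_minus' _ _ _ _ L1 L2). apply is_lim_seq_abs in L.
  apply (is_lim_seq_le _ (fun n => Cmod c * M * A * (tau - approach tau n)) _ 0) in L.
  - simpl in L. assert (P := Rabs_pos (kernel_limit tau u chi1 0 c z - kernel_limit tau u chi2 0 c z)).
    assert (Q : Rabs (kernel_limit tau u chi1 0 c z - kernel_limit tau u chi2 0 c z) = 0) by lra.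
    apply Rabs_eq_0 in Q. lra.
  - intros n. assert (An := approach_bounds T tau Ht n). set (s := approach tau n) in *.
    assert (Sk : smooth (fun y => heat_kernel tau 0 c z y s)).
    { apply (heat_kernel_backward tau 0 c z ltac:(lia)). lra. }
    replace (localized u chi1 (heat_kernel tau 0 c z) s - localized u chi2 (heat_kernel tau 0 c z) s)
      with (pairing u (fun y => f y * heat_kernel tau 0 c z y s) s).
    + replace (Cmod c * M * A * (tau - s)) with (Cmod c * (M * (tau - s)) * A) by ring.
      assert (PB : 0 <= Cmod c * (M * (tau - s))).
      { apply Rmult_le_pos; [apply Cmod_ge_0|]. apply Rmult_le_pos; lra. }
      eapply Rle_trans; [apply (pairing_weighted T tau u Hu Ht) with (M := Cmod c * (M * (tau - s))); auto|].
      * intros y. now apply smooth_continuous.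
      * lra.
      * intros y Hy Hf. eapply Rle_trans; [apply Rabs_heat_kernel|].
        apply Rmult_le_compat_l; [apply Cmod_ge_0|]. apply HM.
        apply (square_admissible r e); auto; try lra.
        -- unfold e, l1norm in *. lra.
        -- apply Rabs_lt_between; lra.
        -- left. apply Rnot_lt_le. intros Hy'. apply Hf. unfold f. rewrite E1, E2 by lra. ring.
      * apply Rmult_le_compat_l; auto. apply HA. lra.
    + assert (I : forall chi, smooth chi -> supported chi (-1) 1 ->
        ex_RInt (fun y => chi y * heat_kernel tau 0 c z y s * u y s) (-1) 1).
      { intros chi Sc Pc. apply (ex_RInt_weak_heat T u Hu (fun y => chi y * heat_kernel tau 0 c z y s)); [| |lra].
        - intros y. now apply smooth_continuous, smooth_mult.
        - now apply supported_mult. }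
      unfold localized, pairing. rewrite <- RInt_Rminus by auto.
      apply RInt_ext. intros y _. unfold f. Rring.
  - apply approach_gap_lim.
Qed.

(** * The Gaussian integral and the approximate identity *)

Definition gauss_int (x : R) : R := RInt (fun v => exp (- v ^ 2 / 4)) 0 x.

Lemma gauss_density_continuous (v : R) : continuous (fun v => exp (- v ^ 2 / 4)) v.
Proof.
  apply (ex_derive_continuous (fun v => exp (- v ^ 2 / 4))). auto_derive. auto.
Qed.

Lemma gauss_int_chasles (x y : R) :
  RInt (fun v => exp (- v ^ 2 / 4)) x y = gauss_int y - gauss_int x.
Proof.
  assert (E : forall a b, ex_RInt (fun v => exp (- v ^ 2 / 4)) a b).
  { intros. apply ex_RInt_cont, gauss_density_continuous. }
  assert (H := RInt_Chasles (fun v => exp (- v ^ 2 / 4)) 0 x y (E _ _) (E _ _)).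
  change (gauss_int x + RInt (fun v => exp (- v ^ 2 / 4)) x y = gauss_int y) in H. lra.
Qed.

Lemma gauss_int_incr (x y : R) : x <= y -> gauss_int x <= gauss_int y.
Proof.
  intros H. assert (P : 0 <= RInt (fun v => exp (- v ^ 2 / 4)) x y).
  { apply RInt_ge_0; auto; [apply ex_RInt_cont, gauss_density_continuous|].
    intros; left; apply exp_pos. }
  rewrite gauss_int_chasles in P. lra.
Qed.

Lemma gauss_int_odd (x : R) : gauss_int (- x) = - gauss_int x.
Proof.
  unfold gauss_int.
  assert (H := RInt_comp (fun v => exp (- v ^ 2 / 4)) (fun v => - v) (fun _ => -1) 0 x).
  cbv beta in H. rewrite Ropp_0 in H. rewrite <- H.
  - rewrite (RInt_ext _ (fun v => -1 * exp (- v ^ 2 / 4))).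
    + rewrite RInt_Rscal; [Rring|apply ex_RInt_cont, gauss_density_continuous].
    + intros v _. unfold scal; simpl; unfold mult; simpl. do 2 f_equal. field.
  - intros v _. apply gauss_density_continuous.
  - intros v _. split; [auto_derive; auto; ring|apply continuous_const].
Qed.

(** Since (v / 2 - 1)^2 >= 0, the density is at most exp(1 - v), whose primitive is explicit. *)
Lemma gauss_int_le (x : R) : 0 <= x -> gauss_int x <= exp 1.
Proof.
  intros Hx. apply Rle_trans with (RInt (fun v => exp (1 - v)) 0 x).
  - apply RInt_le; auto.
    + apply ex_RInt_cont, gauss_density_continuous.
    + apply ex_RInt_cont. intros v. apply (ex_derive_continuous (fun v => exp (1 - v))). auto_derive. auto.
    + intros v _. apply exp_le. assert (0 <= (v / 2 - 1) ^ 2) by apply pow2_ge_0. nra.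
  - replace (RInt (fun v => exp (1 - v)) 0 x) with (minus (- exp (1 - x)) (- exp (1 - 0))).
    + unfold minus, plus, opp; simpl. rewrite Rminus_0_r. assert (P := exp_pos (1 - x)). lra.
    + symmetry. apply is_RInt_unique, (is_RInt_derive (fun v => - exp (1 - v))).
      * intros v _. auto_derive; auto. unfold Rminus; ring.
      * intros v _. apply (ex_derive_continuous (fun v => exp (1 - v))). auto_derive. auto.
Qed.

(** g is the supremum, reached in the limit by monotonicity. Its value is sqrt(pi), but it serves
    only as a normalising constant. *)
Lemma gauss_int_lim : exists g, 0 < g /\ (forall x, gauss_int x <= g) /\
  forall eps, 0 < eps -> exists x0, 0 < x0 /\ forall x, x0 <= x -> Rabs (gauss_int x - g) < eps.
Proof.
  destruct (completeness (fun y => exists x, y = gauss_int x)) as [g [Ub Lb]].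
  - exists (exp 1). intros y [x ->]. destruct (Rle_dec 0 x) as [H|H]; [now apply gauss_int_le|].
    eapply Rle_trans; [apply (gauss_int_incr x 0); lra|apply gauss_int_le; lra].
  - exists (gauss_int 0). now exists 0.
  - assert (U : forall x, gauss_int x <= g) by (intros x; apply Ub; now exists x).
    exists g. split; [|split; auto].
    + apply Rlt_le_trans with (gauss_int 1); auto.
      apply RInt_gt_0; [lra| |]; intros; [apply exp_pos|apply gauss_density_continuous].
    + intros eps He.
      assert (N : ~ forall x, 0 < x -> gauss_int x <= g - eps).
      { intros N. assert (g <= g - eps); [|lra]. apply Lb. intros y [x ->].
        apply Rle_trans with (gauss_int (Rabs x + 1)).
        - apply gauss_int_incr. assert (X := Rle_abs x). lra.
        - apply N. assert (X := Rabs_pos x). lra. }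
      apply not_all_ex_not in N. destruct N as [x0 N].
      apply imply_to_and in N. destruct N as [P0 N].
      exists x0. split; auto. intros x Hx. assert (I := gauss_int_incr x0 x Hx). specialize (U x).
      apply Rabs_lt_between. lra.
Qed.

Lemma heat_kernel_real (tau x y s : R) : s < tau ->
  heat_kernel tau 0 (RtoC 1) (RtoC x) y s = / sqrt (tau - s) * exp (- ((y - x) * / sqrt (tau - s)) ^ 2 / 4).
Proof.
  intros Hs. unfold heat_kernel, gkernel, gker, gauss, Re, Im; simpl.
  replace ((x + - y) * (0 + - 0) / (2 * (tau - s))) with 0 by (field; lra).
  rewrite cos_0, sin_0.
  assert (E : (/ sqrt (tau - s)) * (/ sqrt (tau - s)) = / (tau - s)).
  { rewrite <- (inv_sqrt_sq (tau - s)) by lra. ring. }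
  replace (- ((y - x) * / sqrt (tau - s) * ((y - x) * / sqrt (tau - s) * 1)) / 4)
    with (- ((x + - y) * ((x + - y) * 1) - (0 + - 0) * ((0 + - 0) * 1)) / (4 * (tau - s))).
  - ring.
  - replace ((y - x) * / sqrt (tau - s) * ((y - x) * / sqrt (tau - s) * 1)) with
      ((y - x) ^ 2 * (/ sqrt (tau - s) * / sqrt (tau - s))) by ring.
    rewrite E. field. lra.
Qed.

Lemma heat_kernel_imag (tau x y s : R) : s < tau ->
  heat_kernel tau 0 (- Ci)%C (RtoC x) y s = 0.
Proof.
  intros Hs. unfold heat_kernel, gkernel, gker, gauss, Re, Im; simpl.
  replace ((x + - y) * (0 + - 0) / (2 * (tau - s))) with 0 by (field; lra).
  rewrite cos_0, sin_0. ring.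
Qed.

(** Substitution v = (y - x) / sqrt(tau - s), with the oddness of [gauss_int] at the left end. *)
Lemma heat_kernel_mass (tau x s : R) : s < tau ->
  RInt (fun y => heat_kernel tau 0 (RtoC 1) (RtoC x) y s) (-1) 1 =
  gauss_int ((1 - x) * / sqrt (tau - s)) + gauss_int ((1 + x) * / sqrt (tau - s)).
Proof.
  intros Hs. set (q := / sqrt (tau - s)).
  rewrite (RInt_ext _ (fun y => scal q (exp (- ((y - x) * q) ^ 2 / 4)))).
  2:{ intros y _. rewrite heat_kernel_real by auto. reflexivity. }
  rewrite (RInt_comp (fun v => exp (- v ^ 2 / 4)) (fun y => (y - x) * q) (fun _ => q)).
  - rewrite gauss_int_chasles. replace ((-1 - x) * q) with (- ((1 + x) * q)) by ring.
    rewrite gauss_int_odd. Rring.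
  - intros y _. apply gauss_density_continuous.
  - intros y _. split; [auto_derive; auto; ring|apply continuous_const].
Qed.

Lemma heat_kernel_mass_lim (g : R) :
  (forall eps, 0 < eps -> exists x0, 0 < x0 /\ forall x, x0 <= x -> Rabs (gauss_int x - g) < eps) ->
  forall tau x eps, -1 < x < 1 -> 0 < eps -> exists d, 0 < d /\ forall s, tau - d < s < tau ->
    Rabs (RInt (fun y => heat_kernel tau 0 (RtoC 1) (RtoC x) y s) (-1) 1 - 2 * g) < eps.
Proof.
  intros Hg tau x eps Hx He. destruct (Hg (eps / 2)) as [x0 [P0 H0]]; [lra|].
  set (m := Rmin (1 - x) (1 + x)). assert (Pm : 0 < m) by (apply Rmin_glb_lt; lra).
  assert (M1 : m <= 1 - x) by apply Rmin_l. assert (M2 : m <= 1 + x) by apply Rmin_r.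
  assert (Pmx : 0 < m / x0) by now apply Rdiv_lt_0_compat.
  (* For tau - s below this value both arguments of [gauss_int] exceed x0, m being the distance from
     x to the ends of (-1, 1). *)
  exists ((m / x0) ^ 2). split; [now apply pow_lt|].
  intros s Hs. rewrite heat_kernel_mass by lra.
  assert (Ps : 0 < sqrt (tau - s)) by (apply sqrt_lt_R0; lra).
  set (q := / sqrt (tau - s)). assert (Pq : 0 < q) by now apply Rinv_0_lt_compat.
  assert (Q : x0 <= m * q).
  { assert (S : sqrt (tau - s) <= m / x0).
    { rewrite <- (sqrt_pow2 (m / x0)) by lra. apply sqrt_le_1_alt. lra. }
    unfold q. apply Rmult_le_reg_r with (sqrt (tau - s)); auto.
    replace (m * / sqrt (tau - s) * sqrt (tau - s)) with (x0 * (m / x0)) by (field; lra).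
    apply Rmult_le_compat_l; lra. }
  assert (A1 := H0 ((1 - x) * q) ltac:(nra)). assert (A2 := H0 ((1 + x) * q) ltac:(nra)).
  apply Rabs_lt_between in A1. apply Rabs_lt_between in A2. apply Rabs_lt_between. lra.
Qed.

(** The solution is taken at the moving time s, so joint continuity at (x, tau) is what the
    concentration of the kernel exploits. *)
Lemma kernel_limit_real (T tau r g x : R) (u : R -> R -> R) (chi : R -> R) :
  weak_heat T u -> 0 < tau < T -> r <= 1 -> cutoff r chi -> Rabs x < r ->
  0 < g -> (forall x, gauss_int x <= g) ->
  (forall eps, 0 < eps -> exists x0, 0 < x0 /\ forall x, x0 <= x -> Rabs (gauss_int x - g) < eps) ->
  kernel_limit tau u chi 0 (RtoC 1) (RtoC x) = 2 * g * u x tau.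
Proof.
  intros Hu Ht Hr Hc Hx Pg Ug Lg.
  assert (Hz : l1norm (RtoC x) < r) by (unfold l1norm, Re, Im; simpl; rewrite Rabs_R0; lra).
  assert (L := kernel_limit_correct T tau u Hu Ht r Hr chi Hc 0 (RtoC 1) (RtoC x) ltac:(lia) Hz).
  destruct Hc as [Sc [Pc Ec]].
  assert (Cc := fun y => smooth_continuous _ y Sc).
  assert (Hx1 : -1 < x < 1) by (apply Rabs_lt_between; lra).
  set (W := fun y s => chi y * u y s). set (w := u x tau).
  assert (CW : forall y s, 0 < s < T -> continuity_2d_pt W y s).
  { intros y s Hs. now apply (weak_heat_mult_continuity T u Hu chi). }
  assert (Ww : W x tau = w) by (unfold W; rewrite Ec by lra; unfold w; ring).
  destruct (pairing_mass_bounded T tau u Hu Ht chi (tau / 2)) as [A [PA HA]]; auto; [lra|].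
  set (l := kernel_limit tau u chi 0 (RtoC 1) (RtoC x)) in *.
  (* The term 2 g comes from the region near x, where the kernel has mass at most 2 g; the term |w|
     comes from the defect of the total mass. The far region disappears in the limit. *)
  assert (Key : forall eps, 0 < eps -> Rabs (l - 2 * g * w) <= eps * (2 * g + Rabs w)).
  { intros eps He.
    destruct (CW x tau Ht (mkposreal _ He)) as [d Hd]. rewrite Ww in Hd. simpl in Hd.
    assert (Pd := cond_pos d).
    destruct (gkernel0_small (d ^ 2) tau) as [M [PM HM]]; [now apply pow_lt|lra|].
    destruct (heat_kernel_mass_lim g Lg tau x eps Hx1 He) as [d' [Pd' Hd']].
    assert (L' := is_lim_seq_minus' _ _ _ _ L (is_lim_seq_const (2 * g * w))).
    apply is_lim_seq_abs in L'.
    assert (G := approach_gap_lim tau (M * (A + 2 * Rabs w))).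
    apply (is_lim_seq_plus' _ _ _ _ (is_lim_seq_const (eps * (2 * g + Rabs w)))) in G.
    rewrite Rplus_0_r in G.
    refine (is_lim_seq_le_loc _ _ _ _ _ L' G).
    assert (Pdd : 0 < Rmin d d') by now apply Rmin_glb_lt.
    assert (Lt := proj2 (is_lim_seq_spec _ _) (approach_lim tau) (mkposreal _ Pdd)). simpl in Lt.
    revert Lt. apply filter_imp. intros n Hn.
    assert (An := approach_bounds T tau Ht n). set (s := approach tau n) in *.
    assert (Hn1 := Rmin_l d d'). assert (Hn2 := Rmin_r d d').
    assert (Hsd : Rabs (s - tau) < d) by lra.
    assert (Hsd' : tau - d' < s < tau) by (apply Rabs_lt_between in Hn; lra).
    specialize (Hd' s Hsd').
    set (k := fun y => heat_kernel tau 0 (RtoC 1) (RtoC x) y s) in *.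
    assert (Ck : forall y, continuous k y).
    { intros y. apply smooth_continuous. apply (heat_kernel_backward tau 0 (RtoC 1) (RtoC x) ltac:(lia)). lra. }
    assert (Pk : forall y, 0 <= k y).
    { intros y. unfold k. rewrite heat_kernel_real by lra. apply Rmult_le_pos; [|left; apply exp_pos].
      left. apply Rinv_0_lt_compat, sqrt_lt_R0. lra. }
    assert (N1 : RInt k (-1) 1 <= 2 * g).
    { unfold k. rewrite heat_kernel_mass by lra.
      assert (U1 := Ug ((1 - x) * / sqrt (tau - s))). assert (U2 := Ug ((1 + x) * / sqrt (tau - s))). lra. }
    assert (CWs : forall y, continuous (fun y => W y s) y).
    { intros y. apply (continuity_2d_slice1 W). apply CW. lra. }
    assert (CWd : forall y, continuous (fun y => (W y s - w) * k y) y).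
    { intros y. apply (continuous_mult (fun y => W y s - w) k); auto.
      apply (continuous_minus (fun y => W y s) (fun _ => w)); auto. apply continuous_const. }
    assert (CWa : forall y, continuous (fun y => Rabs (W y s)) y) by (intros; now apply continuous_Rabs_comp).
    assert (CWb : forall y, continuous (fun y => Rabs (W y s) + Rabs w) y).
    { intros y. apply (continuous_plus (fun y => Rabs (W y s)) (fun _ => Rabs w)); auto. apply continuous_const. }
    assert (CS : forall (a : R) f, (forall y : R, continuous f y) -> forall y, continuous (fun y => a * f y) y).
    { intros a f Cf y. apply (continuous_mult (fun _ => a) f); auto. apply continuous_const. }
    assert (E1 : localized u chi (heat_kernel tau 0 (RtoC 1) (RtoC x)) s =
      RInt (fun y => (W y s - w) * k y) (-1) 1 + w * RInt k (-1) 1).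
    { rewrite <- RInt_Rscal, <- RInt_Rplus.
      - apply RInt_ext. intros y _. unfold k, W. Rring.
      - now apply ex_RInt_cont.
      - apply ex_RInt_cont. now apply CS.
      - now apply ex_RInt_cont. }
    assert (E2 : Rabs (RInt (fun y => (W y s - w) * k y) (-1) 1) <=
      eps * (2 * g) + M * (tau - s) * (A + 2 * Rabs w)).
    { eapply Rle_trans; [apply abs_RInt_le; [lra|now apply ex_RInt_cont]|].
      (* Pointwise, the first summand suffices for |y - x| < d and the second elsewhere; adding them
         avoids splitting the integral. *)
      apply Rle_trans with (RInt (fun y => eps * k y + M * (tau - s) * (Rabs (W y s) + Rabs w)) (-1) 1).
      - apply RInt_le; [lra| | |].
        + apply ex_RInt_cont. intros; now apply continuous_Rabs_comp.
        + apply ex_RInt_cont. intros y. apply (continuous_plus (fun y => eps * k y) (fun y => M * (tau - s) * (Rabs (W y s) + Rabs w))).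
          * now apply CS.
          * now apply (CS (M * (tau - s)) (fun y => Rabs (W y s) + Rabs w)).
        + intros y Hy. rewrite Rabs_mult, (Rabs_pos_eq (k y)) by auto.
          assert (Q1 : 0 <= M * (tau - s)) by (apply Rmult_le_pos; lra).
          assert (Q2 := Rabs_pos (W y s)). assert (Q3 := Rabs_pos w). assert (Q4 := Pk y).
          destruct (Rlt_dec (Rabs (y - x)) d) as [D|D].
          * specialize (Hd y s D Hsd).
            assert (Rabs (W y s - w) * k y <= eps * k y) by (apply Rmult_le_compat_r; lra).
            assert (0 <= M * (tau - s) * (Rabs (W y s) + Rabs w)) by (apply Rmult_le_pos; lra). lra.
          * assert (K : k y <= M * (tau - s)).
            { eapply Rle_trans; [apply Rle_abs|]. eapply Rle_trans; [apply Rabs_heat_kernel|].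
              rewrite Cmod_1, Rmult_1_l. apply HM. split; [lra|]. split.
              - replace (RtoC x - RtoC y)%C with (RtoC (x - y)) by (apply RtoC_minus).
                rewrite Cmod_R. apply Rabs_le_between. lra.
              - left. unfold Re, Im; simpl. replace (x + - y) with (- (y - x)) by ring.
                apply Rnot_lt_le in D. rewrite <- (Rabs_Ropp) in D.
                assert (SQ : Rabs (- (y - x)) * Rabs (- (y - x)) = - (y - x) * - (y - x)).
                { rewrite <- Rabs_mult. apply Rabs_pos_eq, Rle_0_sqr. }
                nra. }
            assert (B : Rabs (W y s - w) <= Rabs (W y s) + Rabs w).
            { unfold Rminus. eapply Rle_trans; [apply Rabs_triang|]. rewrite Rabs_Ropp. lra. }
            assert (Rabs (W y s - w) * k y <= (Rabs (W y s) + Rabs w) * (M * (tau - s))).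
            { apply Rmult_le_compat; auto. apply Rabs_pos. }
            assert (0 <= eps * k y) by (apply Rmult_le_pos; lra). lra.
      - rewrite RInt_Rplus, !RInt_Rscal.
        + rewrite RInt_Rplus, RInt_const.
          * assert (HAs := HA s ltac:(lra)). fold (W) in HAs.
            change (RInt (fun y => Rabs (W y s)) (-1) 1 <= A) in HAs.
            change (scal (1 - -1) (Rabs w)) with ((1 - -1) * Rabs w).
            apply Rplus_le_compat; [apply Rmult_le_compat_l; lra|].
            apply Rmult_le_compat_l; [apply Rmult_le_pos; lra|lra].
          * now apply ex_RInt_cont.
          * apply ex_RInt_cont. intros; apply continuous_const.
        + now apply ex_RInt_cont.
        + now apply ex_RInt_cont.
        + apply ex_RInt_cont. now apply CS.
        + apply ex_RInt_cont. now apply (CS (M * (tau - s)) (fun y => Rabs (W y s) + Rabs w)). }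
    rewrite E1.
    replace (RInt (fun y => (W y s - w) * k y) (-1) 1 + w * RInt k (-1) 1 - 2 * g * w) with
      (RInt (fun y => (W y s - w) * k y) (-1) 1 + w * (RInt k (-1) 1 - 2 * g)) by ring.
    eapply Rle_trans; [apply Rabs_triang|]. rewrite (Rabs_mult w).
    assert (Rabs w * Rabs (RInt k (-1) 1 - 2 * g) <= Rabs w * eps).
    { apply Rmult_le_compat_l; [apply Rabs_pos|lra]. }
    lra. }
  apply Rminus_diag_uniq. fold w. apply Rabs_eq_0. apply Rle_antisym; [|apply Rabs_pos].
  apply Rnot_lt_le. intros N.
  assert (P : 0 < 2 * (2 * g + Rabs w)) by (assert (X := Rabs_pos w); lra).
  assert (K := Key (Rabs (l - 2 * g * w) / (2 * (2 * g + Rabs w))) ltac:(now apply Rdiv_lt_0_compat)).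
  replace (Rabs (l - 2 * g * w) / (2 * (2 * g + Rabs w)) * (2 * g + Rabs w)) with (Rabs (l - 2 * g * w) / 2) in K by (field; lra).
  lra.
Qed.

Lemma kernel_limit_imag (tau x : R) (u : R -> R -> R) (chi : R -> R) (T : R) : 0 < tau < T ->
  kernel_limit tau u chi 0 (- Ci)%C (RtoC x) = 0.
Proof.
  intros Ht. unfold kernel_limit. rewrite (Lim_seq_ext _ (fun _ => 0)); [now rewrite Lim_seq_const|].
  intros n. assert (An := approach_bounds T tau Ht n). apply RInt_0_on; [lra|].
  intros y _. rewrite heat_kernel_imag by lra. ring.
Qed.

Lemma weak_heat_holomorphic_extension (T tau g : R) (u : R -> R -> R) :
  weak_heat T u -> 0 < tau < T ->
  0 < g -> (forall x, gauss_int x <= g) ->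
  (forall eps, 0 < eps -> exists x0, 0 < x0 /\ forall x, x0 <= x -> Rabs (gauss_int x - g) < eps) ->
  exists F : C -> C, holomorphic_on square F /\
    forall x, -1 < x < 1 -> F (RtoC x) = RtoC (2 * g * u x tau).
Proof.
  intros Hu Ht Pg Ug Lg.
  (* Each point gets a cutoff whose radius lies halfway between [l1norm z] and 1, so one formula
     defines the extension on the whole square. *)
  set (chi := fun z : C => cutoff_fun ((1 + l1norm z) / 2)).
  exists (fun z => extension tau u (chi z) z). split.
  - intros z Hz. change (l1norm z < 1) in Hz.
    assert (Pz : 0 <= l1norm z) by (apply Rplus_le_le_0_compat; apply Rabs_pos).
    set (r := (1 + l1norm z) / 2) in *.
    assert (Hr : 0 < r < 1) by (unfold r; lra). assert (Hzr : l1norm z < r) by (unfold r; lra).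
    assert (Cr := cutoff_fun_cutoff r Hr).
    destruct (extension_remainder T tau u Hu Ht r ltac:(lra) (cutoff_fun r) Cr z Hzr) as [A [PA HA]].
    (* Near z the cutoff may be frozen: both are cutoffs for the smaller of the two radii, which
       still exceeds [l1norm w]. *)
    assert (Loc : forall w, l1norm w < r -> extension tau u (chi w) w = extension tau u (cutoff_fun r) w).
    { intros w Hw. assert (Pw : 0 <= l1norm w) by (apply Rplus_le_le_0_compat; apply Rabs_pos).
      set (r' := (1 + l1norm w) / 2). assert (Hr' : 0 < r' < 1) by (unfold r'; lra).
      assert (Cr' := cutoff_fun_cutoff r' Hr').
      assert (Mono : forall a chi, Rmin r r' <= a -> cutoff a chi -> cutoff (Rmin r r') chi).
      { intros a chi' Ha [Q1 [Q2 Q3]]. split; [auto|split; auto]. intros y Hy. apply Q3. lra. }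
      assert (Hm : Rmin r r' <= 1) by (eapply Rle_trans; [apply Rmin_l|lra]).
      assert (Hwm : l1norm w < Rmin r r') by (apply Rmin_glb_lt; unfold r' in *; lra).
      unfold extension. f_equal; apply (kernel_limit_cutoff_indep T tau (Rmin r r')); auto.
      - apply (Mono r'); auto. apply Rmin_r.
      - apply (Mono r); auto. apply Rmin_l.
      - apply (Mono r'); auto. apply Rmin_r.
      - apply (Mono r); auto. apply Rmin_l. }
    exists (extension' tau u (cutoff_fun r) z).
    apply is_derive_C_quadratic with ((r - l1norm z) / 4) A; [lra|auto|].
    intros h Hh. rewrite !Loc; auto.
    + apply HA. lra.
    + assert (L := l1norm_plus z h). lra.
  - intros x Hx.
    assert (Hx' : Rabs x < 1) by now apply Rabs_lt_between.
    assert (Ex : l1norm (RtoC x) = Rabs x) by (unfold l1norm, Re, Im; simpl; rewrite Rabs_R0; ring).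
    assert (Px := Rabs_pos x).
    unfold extension, chi. rewrite Ex, (kernel_limit_imag tau x u _ T Ht).
    rewrite (kernel_limit_real T tau ((1 + Rabs x) / 2) g); auto; try lra.
    apply cutoff_fun_cutoff. lra.
Qed.

(** * Distributional solutions *)

Lemma heat_adjoint_prod (al be : R -> R) (x t : R) : smooth al -> smooth be ->
  heat_adjoint (fun x t => al x * be t) x t = al x * Derive be t + Derive (Derive al) x * be t.
Proof.
  intros Sa Sb. unfold heat_adjoint. f_equal.
  - apply Derive_scal.
  - change (Derive (fun y => Derive (fun z => al z * be t) y) x = Derive (Derive al) x * be t).
    rewrite (Derive_ext _ (fun y => Derive al y * be t)); intros; apply Derive_scal_l.
Qed.

Lemma test_function_prod (T : R) (al be : R -> R) : smooth al -> supported al (-1) 1 ->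
  smooth be -> supported be 0 T -> test_function T (fun x t => al x * be t).
Proof.
  intros Sa [a [b [Ha [Hb Pa]]]] Sb [c [d [Hc [Hd Pb]]]]. split.
  - intros n x t. now apply ex_diff_n_prod.
  - exists a, b, c, d. do 4 (split; auto). intros x t H.
    assert (D : ~ a <= x <= b \/ ~ c <= t <= d) by lra.
    destruct D as [D|D]; [rewrite Pa by auto|rewrite Pb by auto]; ring.
Qed.

(** Real test functions let the complex identity split into components. *)
Lemma heat_solution_weak (T : R) (psi : R -> R -> C) : 0 < T -> heat_solution T psi ->
  weak_heat T (fun x t => Re (psi x t)) /\ weak_heat T (fun x t => Im (psi x t)).
Proof.
  intros HT [Cpsi Hpsi].
  assert (Cre : forall x t, -1 < x < 1 -> 0 < t < T -> continuity_2d_pt (fun x t => Re (psi x t)) x t).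
  { intros x t Hx Ht. apply continuity_2d_pt_filterlim.
    apply (continuous_comp (fun q : R * R => psi (fst q) (snd q)) (fun z : R * R => fst z) (x, t)).
    - apply (Cpsi (x, t)). now split.
    - apply continuous_fst. }
  assert (Cim : forall x t, -1 < x < 1 -> 0 < t < T -> continuity_2d_pt (fun x t => Im (psi x t)) x t).
  { intros x t Hx Ht. apply continuity_2d_pt_filterlim.
    apply (continuous_comp (fun q : R * R => psi (fst q) (snd q)) (fun z : R * R => snd z) (x, t)).
    - apply (Cpsi (x, t)). now split.
    - apply continuous_snd. }
  assert (Main : forall al be, smooth al -> supported al (-1) 1 -> smooth be -> supported be 0 T ->
    RInt (fun t => RInt (fun x => (al x * Derive be t + Derive (Derive al) x * be t) * Re (psi x t)) (-1) 1) 0 T = 0 /\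
    RInt (fun t => RInt (fun x => (al x * Derive be t + Derive (Derive al) x * be t) * Im (psi x t)) (-1) 1) 0 T = 0).
  { intros al be Sa Pa Sb Pb.
    specialize (Hpsi _ (test_function_prod T al be Sa Pa Sb Pb)).
    set (I := fun (v : R -> R -> R) t =>
      RInt (fun x => (al x * Derive be t + Derive (Derive al) x * be t) * v x t) (-1) 1) in *.
    assert (Sa2 := smooth_Derive _ (smooth_Derive _ Sa)).
    assert (Pa2 := supported_Derive _ _ _ (supported_Derive _ _ _ Pa)).
    (* Taking components commutes with [RInt] once both component integrals exist, so the inner and
       outer integrability are proved here. *)
    assert (K : forall v : R -> R -> R, (forall x t, -1 < x < 1 -> 0 < t < T -> continuity_2d_pt v x t) ->
      (forall t, 0 < t < T -> ex_RInt (fun x => (al x * Derive be t + Derive (Derive al) x * be t) * v x t) (-1) 1)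
      /\ ex_RInt (I v) 0 T).
    { intros v Cv.
      assert (C1 : forall f, smooth f -> supported f (-1) 1 -> forall x t, 0 < t < T -> continuity_2d_pt (fun x t => f x * v x t) x t).
      { intros f Sf Pf x t Ht. apply (supported_mult_continuity_2d f v (-1) 1); auto.
        intros y; now apply smooth_continuous. }
      assert (C2 : forall f, smooth f -> supported f (-1) 1 -> forall t, 0 < t < T -> ex_RInt (fun x => f x * v x t) (-1) 1).
      { intros f Sf Pf t Ht. apply ex_RInt_cont. intros x.
        apply (continuity_2d_slice1 (fun x t => f x * v x t)). now apply C1. }
      assert (C3 : forall f, smooth f -> supported f (-1) 1 -> forall t, 0 < t < T -> continuous (pairing v f) t).
      { intros f Sf Pf t Ht. apply (continuous_RInt_param (fun x t => f x * v x t)); [lra|].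
        generalize (locally_interval _ _ _ Ht). apply filter_imp. intros s Hs x _. now apply C1. }
      (* Separating variables shows the inner integral to be a compactly supported continuous
         function of t. *)
      assert (C4 : forall t, 0 < t < T -> is_RInt (fun x => (al x * Derive be t + Derive (Derive al) x * be t) * v x t) (-1) 1
        (Derive be t * pairing v al t + be t * pairing v (Derive (Derive al)) t)).
      { intros t Ht.
        apply (is_RInt_ext (fun x => plus (scal (Derive be t) (al x * v x t)) (scal (be t) (Derive (Derive al) x * v x t)))).
        { intros x _. unfold plus, scal; simpl; unfold mult; simpl. Rring. }
        apply (@is_RInt_plus R_NormedModule);
          apply (@is_RInt_scal R_NormedModule), (@RInt_correct R_CompleteNormedModule), C2; auto. }
      split.
      - intros t Ht. eexists. now apply C4.
      - apply (ex_RInt_ext (fun t => Derive be t * pairing v al t + be t * pairing v (Derive (Derive al)) t)).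
        + intros t. rewrite Rmin_left, Rmax_right by lra. intros Ht. symmetry. now apply is_RInt_unique, C4.
        + apply ex_RInt_cont. intros t.
          apply (continuous_plus (fun t => Derive be t * pairing v al t) (fun t => be t * pairing v (Derive (Derive al)) t)).
          * apply (supported_mult_continuous _ _ 0 T); auto.
            -- intros y. now apply smooth_continuous, smooth_Derive.
            -- now apply supported_Derive.
          * apply (supported_mult_continuous _ _ 0 T); auto. intros y. now apply smooth_continuous. }
    destruct (K _ Cre) as [K1 K2]. destruct (K _ Cim) as [K3 K4].
    assert (E : RInt (V := C_R_CompleteNormedModule)
      (fun t => RInt (V := C_R_CompleteNormedModule)
         (fun x => Cmult (RtoC (heat_adjoint (fun x t => al x * be t) x t)) (psi x t)) (-1) 1) 0 T =
      (RInt (I (fun x t => Re (psi x t))) 0 T, RInt (I (fun x t => Im (psi x t))) 0 T)).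
    { apply (@is_RInt_unique C_R_CompleteNormedModule).
      apply (@is_RInt_ext C_R_NormedModule (fun t => (I (fun x t => Re (psi x t)) t, I (fun x t => Im (psi x t)) t))).
      - intros t. rewrite Rmin_left, Rmax_right by lra. intros Ht. symmetry.
        apply (@is_RInt_unique C_R_CompleteNormedModule).
        apply (@is_RInt_ext C_R_NormedModule (fun x =>
          ((al x * Derive be t + Derive (Derive al) x * be t) * Re (psi x t),
           (al x * Derive be t + Derive (Derive al) x * be t) * Im (psi x t)))).
        + intros x _. rewrite heat_adjoint_prod by auto.
          apply injective_projections; unfold Re, Im; simpl; ring.
        + apply (@is_RInt_fct_extend_pair R_NormedModule R_NormedModule); simpl;
            apply (@RInt_correct R_CompleteNormedModule); auto.
      - apply (@is_RInt_fct_extend_pair R_NormedModule R_NormedModule); simpl;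
          apply (@RInt_correct R_CompleteNormedModule); auto. }
    rewrite E in Hpsi. injection Hpsi. auto. }
  split.
  - exact (conj Cre (fun al be Sa Pa Sb Pb => proj1 (Main al be Sa Pa Sb Pb))).
  - exact (conj Cim (fun al be Sa Pa Sb Pb => proj2 (Main al be Sa Pa Sb Pb))).
Qed.

Lemma ex_derive_Cscal (c : C) (f : C -> C) (z : C) :
  ex_derive (K := C_AbsRing) (V := C_NormedModule) f z ->
  ex_derive (K := C_AbsRing) (V := C_NormedModule) (fun z => c * f z)%C z.
Proof.
  intros [l H]. exists (c * l)%C.
  apply (filterdiff_ext_lin (K := C_AbsRing) (U := AbsRing_NormedModule C_AbsRing) (V := C_NormedModule) _ (fun y => scal c (scal y l))).
  - apply (filterdiff_scal_r_fct (K := C_AbsRing) (U := AbsRing_NormedModule C_AbsRing) (V := C_NormedModule) c f _ Cmult_comm H).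
  - intros y. change (c * (y * l) = y * (c * l))%C. ring.
Qed.

Theorem theorem2p1 (T : R) (hT : 0 < T) (psi : R -> R -> C)
    (hpsi : heat_solution T psi) (T' : R) (hT' : 0 < T' < T) :
  exists f : C -> C,
    holomorphic_on square f /\
    forall x : R, -1 < x < 1 -> f (RtoC x) = psi x T'.
Proof.
  destruct gauss_int_lim as [g [Pg [Ug Lg]]].
  destruct (heat_solution_weak T psi hT hpsi) as [Wre Wim].
  destruct (weak_heat_holomorphic_extension T T' g _ Wre hT' Pg Ug Lg) as [F [HF EF]].
  destruct (weak_heat_holomorphic_extension T T' g _ Wim hT' Pg Ug Lg) as [G [HG EG]].
  (* [F] and [G] extend 2 g times the real and imaginary parts of the solution; they need not be
     real off the axis. *)
  exists (fun z => RtoC (/ (2 * g)) * (F z + Ci * G z))%C. split.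
  - intros z Hz.
    apply (ex_derive_Cscal (RtoC (/ (2 * g))) (fun z => F z + Ci * G z)%C).
    apply (@ex_derive_plus C_AbsRing C_NormedModule F (fun z => Ci * G z)%C z); [now apply HF|].
    now apply ex_derive_Cscal, HG.
  - intros x Hx. rewrite EF, EG by auto.
    apply injective_projections; unfold Re, Im; simpl; field; lra.
Qed.
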